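(* Let $Z=(X,Y)$ be a non-smooth vector field (NSVF) defined over a compact invariant set $K\subset\mathbb{R}^2$, with escaping region $\Sigma^e\neq\emptyset$. Assume there exists a nondegenerate closed interval $J\subset\Sigma^e$ such that for all $x\in J$ there is a trajectory $\gamma_x$ that escapes through $x$ to $\Sigma^+$ (or, for all $x\in J$, one that escapes through $x$ to $\Sigma^-$) and, after escaping, $\gamma_x$ intersects $J$ in finite time. Then $h(Z)=\infty$.
   Context: NSVF. Let $U\subset\mathbb{R}^2$ be open and $f:\mathbb{R}^2\to\mathbb{R}$ a $C^r$ function ($r>1$ large enough) having $0$ as a regular value; $\Sigma=f^{-1}(0)\cap U$, $\Sigma^{+}=\{q\in U: f(q)>0\}$, $\Sigma^{-}=\{q\in U: f(q)<0\}$. A NSVF $Z=(X,Y)$ is given by $Z=X$ on $\Sigma^+$ and $Z=Y$ on $\Sigma^-$, where $X,Y$ are $C^r$ vector fields on $\overline{\Sigma^+}$, $\overline{\Sigma^-}$ (extendable to $C^r$ vector fields on open sets containing them), with flows $\phi_X,\phi_Y$. Put $Xf(p)=\langle\nabla f(p),X(p)\rangle$, $X^2f(p)=\langle\nabla (Xf)(p),X(p)\rangle$, and similarly for $Y$. When $Z$ is considered over $K$, the regions of $\Sigma$ below are understood within $K$. Regions of $\Sigma$: $\Sigma^{c+}=\{Xf>0,Yf>0\}$, $\Sigma^{c-}=\{Xf<0,Yf<0\}$ (crossing); $\Sigma^{s}=\{Xf<0,Yf>0\}$ (sliding); $\Sigma^{e}=\{Xf>0,Yf<0\}$ (escaping).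 A tangency point is $p\in\Sigma$ with $Xf(p)\,Yf(p)=0$. A fold of $X$ is a point with $Xf(p)=0\ne X^2f(p)$; it is visible if $X^2f(p)>0$ and invisible if $X^2f(p)<0$; for $Y$ the two inequalities are interchanged. A tangency point is singular if it is an invisible tangency for both $X$ and $Y$, and regular otherwise. The sliding vector field on $\Sigma^s\cup\Sigma^e$ is $Z^s=\dfrac{(Yf)X-(Xf)Y}{Yf-Xf}$, extended to $\overline{\Sigma^s}\cup\overline{\Sigma^e}$. Local trajectories through $p$ ($t$ in an interval $I\ni 0$, origin of time at $p$; $\phi_X$, $\phi_Y$, $\phi_{Z^s}$ are followed while they remain in $\overline{\Sigma^+}$, $\overline{\Sigma^-}$, $\overline{\Sigma^s}\cup\overline{\Sigma^e}$ respectively): (i) $\phi_X$ if $p\in\Sigma^+$, $\phi_Y$ if $p\in\Sigma^-$; (ii) if $p\in\Sigma^{c+}$: $\phi_Y$ for $t\le0$ and $\phi_X$ for $t\ge0$; if $p\in\Sigma^{c-}$ the same reversing time; (iii) if $p\in\Sigma^e$: $\phi_{Z^s}$ for $t\le 0$ and any one of $\phi_X,\phi_Y,\phi_{Z^s}$ for $t\ge0$; if $p\in\Sigma^s$ the same reversing time; (iv) if $p$ is a regular tangency: $\phi_1$ for $t\le0$ and $\phi_2$ for $t\ge0$, each of $\phi_1,\phi_2$ being any of $\phi_X,\phi_Y,\phi_{Z^s}$; (v) if $p$ is a singular tangency: constantly $p$ for all $t\in\mathbb{R}$. A global trajectory is a curve $\gamma$ defined on $\mathbb{R}$ that is an orientation-preserving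 concatenation of local trajectories $\sigma_i$ on $[t_i,t_{i+1}]$, $i\in\mathbb{Z}$, with matching endpoints and $t_i\to\pm\infty$ as $i\to\pm\infty$. A set $A$ is $Z$-invariant if every maximal trajectory through any point of $A$ is contained in $A$. Escape. A trajectory $\gamma$ escapes $\overline{\Sigma^e}$ at time $s_0$ (through the point $\gamma(s_0)$) if $\gamma(s_0)\in\overline{\Sigma^e}$ and there is $s_1>s_0$ with $\gamma(s)\notin\overline{\Sigma^e}$ for all $s_0<s<s_1$; it escapes to $\Sigma^+$ or to $\Sigma^-$ according to which region contains these points $\gamma(s)$. Entropy of a map. For a continuous self-map $g$ of a metric space $(W,d)$ let $d_n^g(x,y)=\max_{0\le i\le n-1}d(g^i(x),g^i(y))$, let $S_d(g,\varepsilon,n)$ be the minimal cardinality of a set $E\subset W$ such that the open $d^g_n$-balls of radius $\varepsilon$ centered at points of $E$ cover $W$ (with $\log\infty=\infty$), and $h(g)=\lim_{\varepsilon\to0}\limsup_{n\to\infty}\frac1n\log S_d(g,\varepsilon,n)$. Entropy of $Z$ over $K$. $\Omega$ is the set of all global trajectories of $Z$ contained in $K$, with metric $\rho(\gamma_1,\gamma_2)=\sum_{i\in\mathbb{Z}}2^{-|i|}\int_i^{i+1}|\gamma_1(t)-\gamma_2(t)|\,dt$; $F_1:\Omega\to\Omega$, $F_1(\gamma)(\cdot)=\gamma(\cdot+1)$; and $h(Z):=h(F_1)$. *)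

(* Defs.v *)
From HB Require Import structures.
From mathcomp Require Export all_boot all_order all_algebra.
From mathcomp Require Export all_classical all_reals all_analysis.

Set Implicit Arguments.
Unset Strict Implicit.
Unset Printing Implicit Defensive.

Export Order.TTheory GRing.Theory Num.Theory.
Export numFieldNormedType.Exports.

Local Open Scope classical_set_scope.
Local Open Scope ring_scope.

Section Plane.
Context {R : realType}.
Local Notation plane := (R * R)%type.

Definition e1 : plane := (1, 0).
Definition e2 : plane := (0, 1).

Definition dot (u v : plane) : R := u.1 * v.1 + u.2 * v.2.

(* The library norm on R * R is the sup norm: same topology, but not the
   norm |.| of the plane that is used in the metric on trajectories. *)
Definition enorm (u : plane) : R := Num.sqrt (dot u u).

Definition grad (g : plane -> R) (p : plane) : plane :=
  ('D_e1 g p, 'D_e2 g p).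

(* For W open: all partial derivatives of order <= n exist and are
   continuous on W. *)
Fixpoint smooth_on (W : set plane) (n : nat) (g : plane -> R) : Prop :=
  {in W, continuous g} /\
  if n is m.+1 then
    [/\ forall p, W p -> derivable g p e1 /\ derivable g p e2,
        smooth_on W m ('D_e1 g) & smooth_on W m ('D_e2 g)]
  else True.

Definition smooth_field_on (W : set plane) (n : nat) (V : plane -> plane) :=
  smooth_on W n (fun p => (V p).1) /\ smooth_on W n (fun p => (V p).2).

Definition lie (V : plane -> plane) (g : plane -> R) (p : plane) : R :=
  dot (grad g p) (V p).

Definition derive_within (I : set R) (c : R -> plane) (t : R) (v : plane) :=
  (s - t)^-1 *: (c s - c t) @[s --> within I t^'] --> v.

(* The field is given by the relation "V p v", v being its value at p, so
   that it may be undefined at some points. *)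
Definition integral_curve (S : set plane) (V : plane -> plane -> Prop)
    (I : set R) (c : R -> plane) : Prop :=
  forall t, I t ->
    S (c t) /\ exists2 v, V (c t) v & derive_within I c t v.

End Plane.

Section NSVF.
Context {R : realType}.
Local Notation plane := (R * R)%type.

(* A non-smooth vector field Z = (X, Y) of class C^r.  Z equals X on
   {f > 0} and Y on {f < 0}; here X and Y stand for C^r extensions of the two
   fields, as every notion below depends only on their values on the closures
   of the two regions. *)
Record nsvf (r : nat) := Nsvf {
  dom : set plane;
  sw : plane -> R;
  fX : plane -> plane;
  fY : plane -> plane;
  dom_open : open dom;
  sw_smooth : smooth_on setT r sw;
  sw_regular : forall p, sw p = 0 -> grad sw p != 0;
  fX_smooth : exists W, [/\ open W,
    closure [set q | dom q /\ 0 < sw q] `<=` W & smooth_field_on W r fX];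
  fY_smooth : exists W, [/\ open W,
    closure [set q | dom q /\ sw q < 0] `<=` W & smooth_field_on W r fY] }.

Context {r : nat} (Z : nsvf r).

Definition sigma : set plane := [set q | dom Z q /\ sw Z q = 0].
Definition sigma_plus : set plane := [set q | dom Z q /\ 0 < sw Z q].
Definition sigma_minus : set plane := [set q | dom Z q /\ sw Z q < 0].

Definition Xf : plane -> R := lie (fX Z) (sw Z).
Definition Yf : plane -> R := lie (fY Z) (sw Z).
Definition X2f : plane -> R := lie (fX Z) Xf.
Definition Y2f : plane -> R := lie (fY Z) Yf.

Definition sigma_cplus := [set p | [/\ sigma p, 0 < Xf p & 0 < Yf p]].
Definition sigma_cminus := [set p | [/\ sigma p, Xf p < 0 & Yf p < 0]].
Definition sigma_s := [set p | [/\ sigma p, Xf p < 0 & 0 < Yf p]].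
Definition sigma_e := [set p | [/\ sigma p, 0 < Xf p & Yf p < 0]].

Definition tangency := [set p | sigma p /\ Xf p * Yf p = 0].
Definition invisible_fold_X (p : plane) := Xf p = 0 /\ X2f p < 0.
Definition invisible_fold_Y (p : plane) := Yf p = 0 /\ 0 < Y2f p.
Definition singular_tangency :=
  [set p | [/\ sigma p, invisible_fold_X p & invisible_fold_Y p]].
Definition regular_tangency := tangency `\` singular_tangency.

Definition sliding (p : plane) : plane :=
  (Yf p - Xf p)^-1 *: (Yf p *: fX Z p - Xf p *: fY Z p).

(* The sliding field extended by continuity: v is its value at p. *)
Definition sliding_ext (p v : plane) : Prop :=
  sliding q @[q --> within (sigma_s `|` sigma_e) (nbhs p)] --> v.

Inductive flow := FlowX | FlowY | FlowS.

Definition follows (m : flow) : set R -> (R -> plane) -> Prop :=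
  match m with
  | FlowX => integral_curve (closure sigma_plus) (fun p v => v = fX Z p)
  | FlowY => integral_curve (closure sigma_minus) (fun p v => v = fY Z p)
  | FlowS => integral_curve (closure sigma_s `|` closure sigma_e) sliding_ext
  end.

Definition past (I : set R) : set R := I `&` [set t | t <= 0].
Definition future (I : set R) : set R := I `&` [set t | 0 <= t].

(* The clauses of the definition of a local trajectory c : I -> R^2 through
   the point c 0. *)
Variant local_clause (I : set R) (c : R -> plane) : Prop :=
| LocalPlus of sigma_plus (c 0) & follows FlowX I c
| LocalMinus of sigma_minus (c 0) & follows FlowY I c
| LocalCrossPlus of sigma_cplus (c 0) &
    follows FlowY (past I) c & follows FlowX (future I) c
| LocalCrossMinus of sigma_cminus (c 0) &
    follows FlowX (past I) c & follows FlowY (future I) c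
| LocalEscaping m of sigma_e (c 0) &
    follows FlowS (past I) c & follows m (future I) c
| LocalSliding m of sigma_s (c 0) &
    follows m (past I) c & follows FlowS (future I) c
| LocalRegular m1 m2 of regular_tangency (c 0) &
    follows m1 (past I) c & follows m2 (future I) c
| LocalSingular of singular_tangency (c 0) & forall t, I t -> c t = c 0.

Definition local_trajectory (I : set R) (c : R -> plane) : Prop :=
  [/\ is_interval I, I 0 & local_clause I c].

(* g restricted to [a, b] is a local trajectory whose time 0 is put at s. *)
Definition local_piece (g : R -> plane) (a b : R) : Prop :=
  exists2 s, s \in `[a, b] &
    local_trajectory `[a - s, b - s] (fun u => g (s + u)).

(* N is the set of indices i of the pieces [t_i, t_(i+1)]. *)
Definition concatenation (N : set int) (t : int -> R) (g : R -> plane) : Prop :=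
  forall i, N i -> t i < t (i + 1) /\ local_piece g (t i) (t (i + 1)).

Definition global_trajectory (g : R -> plane) : Prop :=
  exists t : int -> R, [/\ concatenation setT t g,
    t n%:Z @[n --> \oo] --> +oo & t (- n%:Z) @[n --> \oo] --> -oo].

(* A trajectory parametrized by D: a finite or infinite concatenation.  The
   values of g outside D are irrelevant. *)
Definition trajectory (D : set R) (g : R -> plane) : Prop :=
  exists N : set int, exists t : int -> R,
    [/\ forall i j k, N i -> N k -> i <= j <= k -> N j, concatenation N t g &
        D = \bigcup_(i in N) [set` `[t i, t (i + 1)]] ].

Definition maximal_trajectory (D : set R) (g : R -> plane) : Prop :=
  trajectory D g /\
  forall D' g', trajectory D' g' -> D `<=` D' ->
    (forall t, D t -> g' t = g t) -> D' = D.

Definition invariant (A : set plane) : Prop :=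
  forall D g, maximal_trajectory D g ->
    (exists2 t, D t & A (g t)) -> forall t, D t -> A (g t).

(* The trajectory g : D -> R^2 escapes the closure of E at time s0 to the
   region S. *)
Definition escapes (E S : set plane) (D : set R) (g : R -> plane) (s0 : R) :=
  [/\ D s0, closure E (g s0) & exists2 s1, s0 < s1 &
      forall s, s0 < s < s1 -> [/\ D s, ~ closure E (g s) & S (g s)]].

Definition escapes_and_returns (J E S : set plane) (x : plane) : Prop :=
  exists D g s0, [/\ trajectory D g, g s0 = x, escapes E S D g s0 &
    exists s2, [/\ s0 < s2, D s2 & J (g s2)]].

End NSVF.

(* A nondegenerate closed interval of a curve: a simple arc, endpoints
   included. *)
Definition closed_arc {R : realType} (J : set (R * R)) : Prop :=
  exists c : R -> R * R, [/\ {within `[0, 1], continuous c},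
    {in `[0, 1] &, injective c} & J = c @` [set` `[0, 1]] ].

Local Open Scope ereal_scope.

(* Entropy of the restriction of g to a g-stable set W.  The distance d may be
   extended-real valued, so that the metric on trajectories below need not be
   truncated off the set where it is finite. *)
Section Entropy.
Context {R : realType} {T : Type} (d : T -> T -> \bar R) (W : set T).

Definition dist_n (g : T -> T) (n : nat) (x y : T) : \bar R :=
  \big[maxe/0]_(i < n) d (iter i g x) (iter i g y).

Definition spanning (g : T -> T) (e : R) (n : nat) (E : set T) : Prop :=
  E `<=` W /\ forall x, W x -> exists2 y, E y & dist_n g n y x < e%:E.

(* +oo when there is no finite spanning set. *)
Definition span_card (g : T -> T) (e : R) (n : nat) : \bar R :=
  ereal_inf [set k%:R%:E | k in
    [set k : nat | exists2 E, spanning g e n E & (E #= `I_k)%card]].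

Definition entropy_at (g : T -> T) (e : R) : \bar R :=
  limn_esup (fun n => (n%:R^-1)%:E * lne (span_card g e n)).

Definition entropy (g : T -> T) : \bar R := lim (entropy_at g e @[e --> 0^'+]).

End Entropy.

Section EntropyNSVF.
Context {R : realType} {r : nat} (Z : nsvf (R := R) r) (K : set (R * R)).

Definition Omega : set (R -> R * R) :=
  [set g | global_trajectory Z g /\ forall t, K (g t)].

Definition rho (g1 g2 : R -> R * R) : \bar R :=
  \esum_(i in [set: int])
    ((2^-1 ^+ `|i|%N)%:E *
     \int[lebesgue_measure]_(t in `[i%:~R, (i + 1)%:~R])
        (enorm (g1 t - g2 t))%:E).

Definition time_one (g : R -> R * R) : R -> R * R := fun t => g (t + 1)%R.

Definition nsvf_entropy : \bar R := entropy rho Omega time_one.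

End EntropyNSVF.

(* Main.v *)
(* By transversality a point of the escaping region is only reached by sliding,
   so the return trajectories enter the arc J through one of its endpoints.  At
   such an endpoint p the sliding field either vanishes or points into J; hence
   one can slide from p inside J during any small time tau, possibly staying at
   p, then escape, and enter J again through an endpoint.  There are uncountably
   many tau, two endpoints and countably many integer bounds for the duration, so
   some endpoint p is the base point of infinitely many loops, with distinct exit
   times and durations at most a fixed M.  The words of length m in k of these
   loops give k ^ m trajectories which are pairwise separated, up to time m * M,
   at a scale independent of m.  So the entropy is at least (ln k) / M for all k. *)

Require Import Defs.
From mathcomp Require Import measurable_realfun ring lra zify.

Set Implicit Arguments.
Unset Strict Implicit.
Unset Printing Implicit Defensive.

Local Open Scope classical_set_scope.
Local Open Scope ring_scope.

(** * Differentiability in the plane *)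

Section PlaneAnalysis.
Context {R : realType}.
Local Notation plane := (R * R)%type.
Implicit Types (u v p q : plane).

(** A local trajectory contains its base point, so a trajectory cannot be cut at an arbitrary time.
    Two cuts are harmless: keeping what precedes a point of [sigma_e], which can serve as base point
    because the curve slides up to it, and keeping what follows a time after which the curve runs in
    an open side of Sigma, where a later point becomes the base. Loops are cut exactly in these
    ways, at their exit from J and at their return to it. The sliding field is treated as a merely
    continuous field. A linear coordinate along the tangent at a point is injective on Sigma nearby,
    with Lipschitz inverse, so sliding becomes a scalar autonomous equation, solved by separation of
    variables where the speed is positive. A return may arrive at the other endpoint, so loops at
    one point may need a composition of excursions. The exit time survives composition, since f
    vanishes up to it and not just after it. The same feature separates two loops by an amount that
    does not depend on when they are run, whence one scale for all word lengths. *)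

Lemma normr_fst u : `|u.1| <= `|u|.
Proof. by rewrite prod_normE le_max lexx. Qed.

Lemma normr_snd u : `|u.2| <= `|u|.
Proof. by rewrite prod_normE le_max lexx orbT. Qed.

Lemma normr_pair_le u (e : R) : `|u.1| <= e -> `|u.2| <= e -> `|u| <= e.
Proof. by move=> h1 h2; rewrite prod_normE ge_max h1 h2. Qed.

Lemma dotB u v w : dot u (v - w) = dot u v - dot u w.
Proof. by rewrite /dot /=; ring. Qed.

Lemma dotZ u (a : R) v : dot u (a *: v) = a * dot u v.
Proof. by rewrite /dot /= /GRing.scale /=; ring. Qed.

Lemma dot_le u v : `|dot u v| <= 2 * `|u| * `|v|.
Proof.
have h (a b c d : R) : `|a| <= c -> `|b| <= d -> `|a * b| <= c * d.
  by move=> ? ?; rewrite normrM ler_pM.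
apply: le_trans (ler_normD _ _) _.
have := h _ _ _ _ (normr_fst u) (normr_fst v).
have := h _ _ _ _ (normr_snd u) (normr_snd v).
by rewrite -mulrA mulr_natl mulr2n => h1 h2; exact: lerD.
Qed.

Lemma nbhs_dist {V : normedModType R} (x : V) (P : set V) :
  nbhs x P <-> exists2 d : R, 0 < d & forall y, `|y - x| < d -> P y.
Proof.
split.
  move=> /nbhs_normP[d /= d0 h]; exists d => // q qp; apply: h => /=.
  by rewrite distrC.
move=> [d d0 h]; apply/nbhs_normP; exists d => //= q /=.
by rewrite distrC; exact: h.
Qed.

Lemma closure_dist (A : set plane) p :
  closure A p -> forall d : R, 0 < d -> exists2 q, A q & `|q - p| < d.
Proof.
move=> h d d0; have : nbhs p [set q | `|q - p| < d] by apply/nbhs_dist; exists d.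
by move=> /h [q [? ?]]; exists q.
Qed.

Lemma continuous_dist {V W : normedModType R} (g : V -> W) x :
  {for x, continuous g} <->
  forall e : R, 0 < e ->
    exists2 d : R, 0 < d & forall y, `|y - x| < d -> `|g y - g x| < e.
Proof.
split=> [/cvgrPdist_lt h e /h /nbhs_dist[d d0 hd]|h].
  by exists d => // q /hd; rewrite distrC.
apply/cvgrPdist_lt => e /h [d d0 hd]; apply/nbhs_dist; exists d => // q /hd.
by rewrite distrC.
Qed.

(** Clearing the denominator gives a bound that also holds, trivially, at [s = t], so the puncture
    of the filter disappears. *)
Lemma derive_withinP (I : set R) (c : R -> plane) t v :
  derive_within I c t v <->
  forall e : R, 0 < e -> exists2 d : R, 0 < d & forall s, I s -> `|s - t| < d ->
    `|c s - c t - (s - t) *: v| <= e * `|s - t|.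
Proof.
split.
  move=> /cvgrPdist_le h e /h; rewrite near_withinE => /nbhs_dist[d d0 hd].
  exists d => // s Is st.
  have [->|nst] := eqVneq s t; first by rewrite !subrr scale0r subr0 !normr0 mulr0.
  have st0 : s - t != 0 by rewrite subr_eq0.
  have := hd _ st nst Is; rewrite distrC => hs.
  have -> : c s - c t - (s - t) *: v =
      (s - t) *: ((s - t)^-1 *: (c s - c t) - v).
    by rewrite scalerBr scalerA divff// scale1r.
  by rewrite normrZ mulrC ler_wpM2r.
move=> h; apply/cvgrPdist_le => e /h[d d0 hd].
rewrite near_withinE; apply/nbhs_dist; exists d => // s st nst Is.
have st0 : s - t != 0 by rewrite subr_eq0.
have := hd _ Is st.
have -> : c s - c t - (s - t) *: v =
    (s - t) *: ((s - t)^-1 *: (c s - c t) - v).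
  by rewrite scalerBr scalerA divff// scale1r.
by rewrite normrZ mulrC ler_pM2r ?normr_gt0// distrC.
Qed.

Lemma derive_within_lipschitz {I : set R} {c : R -> plane} {t v} :
  derive_within I c t v ->
  exists C d : R, [/\ 0 < C, 0 < d & forall s, I s -> `|s - t| < d ->
    `|c s - c t| <= C * `|s - t|].
Proof.
move=> /derive_withinP/(_ 1 ltr01)[d d0 hd]; exists (1 + `|v|), d; split => //.
move=> s Is st; have := hd _ Is st; rewrite mul1r => h.
rewrite -[c s - c t](subrK ((s - t) *: v)).
apply: le_trans (ler_normD _ _) _; rewrite mulrDl mul1r lerD// normrZ.
by rewrite mulrC.
Qed.

Lemma derive_within_cts {I : set R} {c : R -> plane} {t v} :
  derive_within I c t v -> forall e : R, 0 < e ->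
  exists2 d : R, 0 < d & forall s, I s -> `|s - t| < d -> `|c s - c t| < e.
Proof.
move=> /derive_within_lipschitz[C [d [C0 d0 h]]] e e0.
exists (Num.min d (e / C)); first by rewrite lt_min d0 divr_gt0.
move=> s Is; rewrite lt_min => /andP[sd se]; apply: le_lt_trans (h _ Is sd) _.
by rewrite mulrC -ltr_pdivlMr.
Qed.

Lemma derive_within_sub {I I' : set R} {c : R -> plane} {t v} :
  I' `<=` I -> derive_within I c t v -> derive_within I' c t v.
Proof.
move=> II' /derive_withinP h; apply/derive_withinP => e /h[d d0 hd].
by exists d => // s /II'; exact: hd.
Qed.

Lemma eq_derive_within {I : set R} {c c' : R -> plane} {t v} :
  I t -> (forall s, I s -> c s = c' s) ->
  derive_within I c t v -> derive_within I c' t v.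
Proof.
move=> It cc' /derive_withinP h; apply/derive_withinP => e /h[d d0 hd].
by exists d => // s Is st; rewrite -!cc' //; exact: hd.
Qed.

Lemma derive_within_shift {I : set R} {c : R -> plane} {t v} (a : R) :
  derive_within I c (a + t) v ->
  derive_within [set s | I (a + s)] (fun s => c (a + s)) t v.
Proof.
move=> /derive_withinP h; apply/derive_withinP => e /h[d d0 hd].
exists d => // s /= Is st.
have e1 : s - t = a + s - (a + t) by ring.
by rewrite e1; apply: hd; rewrite // -e1.
Qed.

Lemma linear_dist2 (a b a' b' dx dy e N : R) :
  `|a - a'| < e / 2 -> `|b - b'| < e / 2 -> `|dx| <= N -> `|dy| <= N ->
  `|b * dy + a * dx - (a' * dx + b' * dy)| <= e * N.
Proof.
move=> ha hb hx hy.
have -> : b * dy + a * dx - (a' * dx + b' * dy) = (a - a') * dx + (b - b') * dy.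
  by ring.
apply: le_trans (ler_normD _ _) _; rewrite !normrM.
have -> : e * N = e / 2 * N + e / 2 * N by field.
by apply: lerD; apply: ler_pM => //; exact: ltW.
Qed.

(* MVT along the two sides of a coordinate rectangle. *)
Lemma strict_differentiable (g : plane -> R) p :
  (forall q, derivable g q e1 /\ derivable g q e2) ->
  {for p, continuous ('D_e1 g)} -> {for p, continuous ('D_e2 g)} ->
  forall e : R, 0 < e -> exists2 d : R, 0 < d & forall q q',
    `|q - p| < d -> `|q' - p| < d ->
    `|g q' - g q - dot (grad g p) (q' - q)| <= e * `|q' - q|.
Proof.
move=> dg /continuous_dist c1 /continuous_dist c2 e e0.
have e20 : 0 < e / 2 by lra.
have [d1 d10 h1] := c1 _ e20; have [d2 d20 h2] := c2 _ e20.
exists (Num.min d1 d2); first by rewrite lt_min d10.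
have D1 (x y : R) : is_derive x (1 : R) (fun z : R => g (z, y)) ('D_e1 g (x, y)).
  have E : (fun h : R => h^-1 *: (((fun z : R => g (z, y)) \o shift x) (h *: (1 : R)) - g (x, y)))
         = (fun h : R => h^-1 *: ((g \o shift (x, y)) (h *: e1) - g (x, y))).
    apply/funext => h /=; congr (_ *: (g _ - _)).
    by apply: injective_projections; rewrite /= /GRing.scale /= ?mulr0 ?add0r ?mulr1.
  apply: DeriveDef; last by rewrite /derive /= E.
  by rewrite /derivable /= E; exact: (dg (x, y)).1.
have D2 (x y : R) : is_derive y (1 : R) (fun z : R => g (x, z)) ('D_e2 g (x, y)).
  have E : (fun h : R => h^-1 *: (((fun z : R => g (x, z)) \o shift y) (h *: (1 : R)) - g (x, y)))
         = (fun h : R => h^-1 *: ((g \o shift (x, y)) (h *: e2) - g (x, y))).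
    apply/funext => h /=; congr (_ *: (g _ - _)).
    by apply: injective_projections; rewrite /= /GRing.scale /= ?mulr0 ?add0r ?mulr1.
  apply: DeriveDef; last by rewrite /derive /= E.
  by rewrite /derivable /= E; exact: (dg (x, y)).2.
have mvt (F dF : R -> R) : (forall x : R, is_derive x 1 F (dF x)) -> forall a b : R,
    exists2 x, `|x - a| <= `|b - a| /\ `|x - b| <= `|b - a| & F b - F a = dF x * (b - a).
  move=> hF a b.
  have cF (x : R) : {for x, continuous F}.
    by apply: differentiable_continuous; apply/derivable1_diffP; have [] := hF x.
  have cF' (x y : R) : {within `[x, y], continuous F}.
    by apply: continuous_subspaceT => z; exact: cF.
  have [ab|ba] := leP a b.
    have [x xab ->] := MVT_segment ab (fun x _ => hF x) (cF' a b).
    move: xab; rewrite in_itv /= => /andP[ax xb]; exists x => //.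
    by split; rewrite ?ler_norml ?ger0_norm; lra.
  have [x xab ha] := MVT_segment (ltW ba) (fun x _ => hF x) (cF' b a).
  move: xab; rewrite in_itv /= => /andP[ax xb]; exists x; last by lra.
  by rewrite [`|b - a|]ltr0_norm ?ler_norml; [lra|lra].
move=> [x y] [x' y']; rewrite !lt_min => /andP[q1 q2] /andP[q1' q2'].
have [z [za zb] hz] := mvt _ _ (D1 ^~ y) x x'.
have [w [wa wb] hw] := mvt _ _ (D2 x') y y'.
(* The two bounds on [z] place it between [x] and [x'], and a sup-norm ball is a square with sides
   parallel to the axes, so the intermediate points stay in it. *)
have near1 (d : R) : `|(x, y) - p| < d -> `|(x', y') - p| < d -> `|(z, y) - p| < d.
  move=> a b; have := le_lt_trans (normr_fst _) a; have := le_lt_trans (normr_fst _) b.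
  have := le_lt_trans (normr_snd _) a; rewrite /= => a2 b1 a1.
  rewrite prod_normE gt_max /= a2 andbT.
  move: za zb a1 b1; case: (leP x x') => xx'.
    by rewrite [`|x' - x|]ger0_norm; rewrite ?ler_norml ?ltr_norml; lra.
  by rewrite [`|x' - x|]ltr0_norm; rewrite ?ler_norml ?ltr_norml; lra.
have near2 (d : R) : `|(x, y) - p| < d -> `|(x', y') - p| < d -> `|(x', w) - p| < d.
  move=> a b; have := le_lt_trans (normr_fst _) b; have := le_lt_trans (normr_snd _) b.
  have := le_lt_trans (normr_snd _) a; rewrite /= => a2 b1 a1.
  rewrite prod_normE gt_max /= a1 /=.
  move: wa wb a2 b1; case: (leP y y') => yy'.
    by rewrite [`|y' - y|]ger0_norm; rewrite ?ler_norml ?ltr_norml; lra.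
  by rewrite [`|y' - y|]ltr0_norm; rewrite ?ler_norml ?ltr_norml; lra.
have -> : g (x', y') - g (x, y) = (g (x', y') - g (x', y)) + (g (x', y) - g (x, y)).
  by rewrite addrA subrK.
rewrite hz hw; apply: linear_dist2.
- exact: h1 _ (near1 _ q1 q1').
- exact: h2 _ (near2 _ q2 q2').
- exact: normr_fst ((x', y') - (x, y)).
- exact: normr_snd ((x', y') - (x, y)).
Qed.

End PlaneAnalysis.

(** * Scalar autonomous equations *)

Section RealAnalysis.
Context {R : realType}.

Lemma within_continuousP (F : R -> R) (a b : R) :
  (forall x, a <= x <= b -> forall e : R, 0 < e -> exists2 d : R, 0 < d &
    forall y, a <= y <= b -> `|y - x| < d -> `|F y - F x| < e) ->
  {within `[a, b], continuous F}.
Proof.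
move=> h; apply/subspace_continuousP => x; rewrite /= in_itv /= => xab.
apply/cvgrPdist_lt => e /(h _ xab)[d d0 hd].
rewrite near_withinE; apply/nbhs_dist; exists d => // y /hd hy; rewrite /= in_itv /=.
by rewrite distrC; exact: hy.
Qed.

Lemma IVT_sym (F : R -> R) (a b v : R) : a <= b -> {within `[a, b], continuous F} ->
  F a <= v <= F b \/ F b <= v <= F a -> exists2 c, a <= c <= b & F c = v.
Proof.
move=> ab cF h; have [|c] := @IVT _ F a b v ab cF; last first.
  by rewrite in_itv /= => ? ?; exists c.
by rewrite ge_min le_max; case: h => /andP[-> ->]; rewrite ?orbT.
Qed.

(* Time is the antiderivative of 1 / F along the solution. *)
Lemma autonomous_ode (F : R -> R) (a b : R) : a < b ->
  (forall x, a <= x <= b -> forall e : R, 0 < e -> exists2 d : R, 0 < d &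
    forall y, a <= y <= b -> `|y - x| < d -> `|F y - F x| < e) ->
  (forall x, a <= x <= b -> 0 < F x) ->
  exists2 T : R, 0 < T & exists u : R -> R, [/\ u 0 = a,
    forall t, 0 <= t <= T -> a <= u t <= b &
    forall t, 0 <= t <= T -> forall e : R, 0 < e -> exists2 d : R, 0 < d &
      forall s, 0 <= s <= T -> `|s - t| < d ->
      `|u s - u t - F (u t) * (s - t)| <= e * `|s - t| ].
Proof.
move=> ab cF F0.
(* Clamping to [[a, b]] extends [F] to a positive continuous function on the line, so the
   fundamental theorem of calculus also applies at [a] and [b], which are interior to the interval
   of integration. *)
pose k x := Num.min b (Num.max a x).
have kab x : a <= k x <= b.
  rewrite /k le_min ge_min lexx /= le_max lexx /= (ltW ab) //.
have kid x : a <= x <= b -> k x = x.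
  by move=> /andP[ax xb]; rewrite /k max_r// min_r.
have kmono x y : x <= y -> 0 <= k y - k x <= y - x.
  rewrite /k => xy; case: (leP a x) => ?; case: (leP a y) => ?;
    rewrite ?(min_r (ltW ab));
    case: (leP b x) => ?; case: (leP b y) => ?; apply/andP; split; lra.
have klip x y : `|k y - k x| <= `|y - x|.
  have [xy|/ltW yx] := leP x y.
    by have /andP[? ?] := kmono _ _ xy; rewrite [leLHS]ger0_norm// ger0_norm ?subr_ge0.
  have /andP[? ?] := kmono _ _ yx; rewrite distrC [leRHS]distrC.
  by rewrite [leLHS]ger0_norm// ger0_norm ?subr_ge0.
pose h x := (F (k x))^-1.
have ck : continuous (F \o k).
  move=> x; apply/continuous_dist => e /(cF _ (kab x))[d d0 hd].
  by exists d => // y yx; apply: hd => //=; exact: le_lt_trans (klip _ _) yx.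
have ch : continuous h.
  by move=> x; apply: cvgV; [rewrite gt_eqF// F0|exact: ck].
have ab1 : a - 1 < b + 1 by lra.
pose mu := @lebesgue_measure R.
pose G x := (\int[mu]_(t in `[a - 1, x]) h t)%R.
have ih : mu.-integrable `[a - 1, b + 1] (EFin \o h).
  apply: continuous_compact_integrable; first exact: segment_compact.
  exact: continuous_subspaceT.
have dG (x : R) : a <= x <= b -> is_derive x (1 : R) G (h x).
  move=> /andP[ax xb].
  have xb1 : x < b + 1 by lra.
  have [||d1 d2] := continuous_FTC1_closed xb1 ih.
  - lra.
  - exact: ch.
  by apply: DeriveDef; [exact: d1|rewrite -derive1E; exact: d2].
have cG : {within `[a, b], continuous G}.
  apply: derivable_within_continuous => x; rewrite in_itv /= => /dG.
  by case.
(* Mean value theorem for [G], solved for [y - x]; it replaces differentiating the inverse of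
   [G]. *)
have mvt x y : a <= x <= b -> a <= y <= b -> exists2 z, a <= z <= b /\ `|z - x| <= `|y - x| &
    y - x = F z * (G y - G x).
  have sub x' y' : a <= x' -> y' <= b -> x' <= y' -> exists2 z, x' <= z <= y' &
     y' - x' = F z * (G y' - G x').
    move=> ax yb xy; have [||z] := @MVT_segment _ G h x' y' xy.
    - by move=> z; rewrite in_itv /= => ?; apply: dG; lra.
    - by apply: continuous_subspaceW cG => z; rewrite /= !in_itv /=; lra.
    rewrite in_itv /= => zxy ->; exists z => //.
    have zab : a <= z <= b by lra.
    by rewrite /h (kid _ zab) mulrA divff ?mul1r// gt_eqF// F0.
  move=> /andP[ax xb] /andP[ay yb]; have [xy|yx] := leP x y.
    have [z zxy hz] := sub _ _ ax yb xy; exists z => //.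
    by split; [lra|rewrite !ger0_norm; lra].
  have [z zxy hz] := sub _ _ ay xb (ltW yx); exists z; last by lra.
  by split; [lra|rewrite !ler0_norm; lra].
have aab : a <= a <= b by lra.
have bab : a <= b <= b by lra.
have Gab : G a < G b.
  have [z [zab _] hz] := mvt _ _ aab bab.
  by have := F0 _ zab; move: hz; nra.
(* [u] inverts [G - G a]; outside the range the value [a] is a default. *)
have uP t : exists u, 0 <= t <= G b - G a -> a <= u <= b /\ G u = G a + t.
  have [ht|nt] := pselect (0 <= t <= G b - G a); last by exists a.
  have [|u ? ?] := IVT_sym (v := G a + t) (ltW ab) cG; first by left; lra.
  by exists u.
have [u hu] := choice uP.
exists (G b - G a); first by lra.
(* [M] bounds the speed, so [u] is [M]-Lipschitz, whence [d / M] below. *)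
have [M M0 hM] : exists2 M, 0 < M & forall x, a <= x <= b -> F x <= M.
  have [c _ hc] := @EVT_max _ (F \o k) a b (ltW ab) (continuous_subspaceT ck).
  exists (F (k c)); first exact: F0.
  by move=> x xab; have := hc x; rewrite /= kid// in_itv /=; exact.
exists u; split.
- have [|u0 Gu0] := hu 0; first by lra.
  have [z [zab _]] := mvt _ _ aab u0.
  by rewrite Gu0 addr0 subrr mulr0 => /eqP; rewrite subr_eq0 => /eqP.
- by move=> t /hu[].
move=> t ht e e0; have [ut Gut] := hu _ ht.
have [d d0 hd] := cF _ ut _ e0.
exists (d / M); first by rewrite divr_gt0.
move=> s hs st; have [us Gus] := hu _ hs.
have [z [zab zu] hz] := mvt _ _ ut us.
have E : G (u s) - G (u t) = s - t by rewrite Gut Gus; ring.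
rewrite hz E -mulrBl normrM; apply: ler_wpM2r => //; apply/ltW/hd => //.
apply: le_lt_trans zu _; rewrite hz E normrM (gtr0_norm (F0 _ zab)).
by apply: le_lt_trans (_ : M * `|s - t| < d);
  [apply: ler_wpM2r => //; exact: hM|rewrite mulrC -ltr_pdivlMr].
Qed.

End RealAnalysis.

(** * Flows near the switching curve *)

Section LocalAnalysis.
Context {R : realType} {r : nat} (r_gt0 : (0 < r)%N) (Z : nsvf (R := R) r).
Local Notation plane := (R * R)%type.
Local Notation f := (sw Z).
Implicit Types (p q v : plane).

Lemma dot_gt0 v : v != 0 -> 0 < dot v v.
Proof.
case: v => a b; rewrite /dot /= => ab.
have := sqr_ge0 a; have := sqr_ge0 b; rewrite !expr2.
have [a0|a0] := eqVneq a 0.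
  have b0 : b != 0 by apply: contraNneq ab => ->; rewrite a0.
  by move=> _ _; rewrite a0 mulr0 add0r -expr2 exprn_even_gt0.
have : 0 < a * a by rewrite -expr2 exprn_even_gt0.
by lra.
Qed.

Lemma smooth_on_continuous W n (g : plane -> R) p :
  smooth_on W n g -> W p -> {for p, continuous g}.
Proof. by case: n => [|n] /= [cg _] Wp; apply: cg; rewrite inE. Qed.

Lemma sw_continuous p : {for p, continuous f}.
Proof. exact: smooth_on_continuous (sw_smooth Z) _. Qed.

Lemma sw_partials :
  [/\ forall q, derivable f q e1 /\ derivable f q e2,
      forall p, {for p, continuous ('D_e1 f)} &
      forall p, {for p, continuous ('D_e2 f)}].
Proof.
case: r r_gt0 Z => // n _ Z'; have [_ [d s1 s2]] := sw_smooth Z'.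
by split=> [q|p|p]; [exact: d|exact: smooth_on_continuous s1 _|
  exact: smooth_on_continuous s2 _].
Qed.

Lemma sw_strict_diff p (e : R) : 0 < e -> exists2 d : R, 0 < d & forall q q',
    `|q - p| < d -> `|q' - p| < d ->
    `|f q' - f q - dot (grad f p) (q' - q)| <= e * `|q' - q|.
Proof.
by move=> e0; have [d c1 c2] := sw_partials; exact: strict_differentiable d (c1 p) (c2 p) e e0.
Qed.

Lemma sw_chain_rule (I : set R) (c : R -> plane) t v : derive_within I c t v ->
  forall e : R, 0 < e -> exists2 d : R, 0 < d & forall s, I s -> `|s - t| < d ->
    `|f (c s) - f (c t) - (s - t) * dot (grad f (c t)) v| <= e * `|s - t|.
Proof.
move=> dc e e0; have [C [d1 [C0 d10 h1]]] := derive_within_lipschitz dc.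
set g := grad f (c t).
(* Two errors of [e / 2] each: strict differentiability of [f] over an increment controlled by [C],
   and the derivative of [c] paired with [g]. In the second, [dot_le] costs a factor 2, and adding 1
   to the norm of [g] keeps the denominator positive. *)
have e20 : 0 < e / (2 * C) by rewrite divr_gt0// mulr_gt0.
have [d2 d20 h2] := sw_strict_diff (c t) e20.
have [d3 d30 h3] := derive_within_cts dc d20.
have e40 : 0 < e / (4 * (1 + `|g|)).
  by rewrite divr_gt0// mulr_gt0// ltr_pwDl.
have [d4 d40 h4] := (derive_withinP _ _ _ _).1 dc _ e40.
exists (Num.min d1 (Num.min d3 d4)); first by rewrite !lt_min d10 d30.
move=> s Is; rewrite !lt_min => /and3P[s1 s3 s4].
have := h2 (c t) (c s); rewrite subrr normr0 => /(_ d20 (h3 _ Is s3)).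
move: (h4 _ Is s4) (h1 _ Is s1) => H4 H1 H2.
have -> : f (c s) - f (c t) - (s - t) * dot g v =
   (f (c s) - f (c t) - dot g (c s - c t)) + dot g (c s - c t - (s - t) *: v).
  by rewrite [in RHS](dotB g (c s - c t)) dotZ; ring.
apply: le_trans (ler_normD _ _) _.
have -> : e * `|s - t| = e / (2 * C) * (C * `|s - t|) +
    2 * (1 + `|g|) * (e / (4 * (1 + `|g|)) * `|s - t|).
  have G0 : 1 + `|g| != 0 by rewrite gt_eqF// ltr_pwDl.
  by field; rewrite G0 gt_eqF.
apply: lerD.
  by apply: le_trans H2 _; apply: ler_wpM2l => //; exact: ltW.
apply: le_trans (dot_le _ _) _; apply: ler_pM => //.
by rewrite ler_wpM2l// lerDr.
Qed.

(** To first order [k * f] increases through 0 at time [t], so it is negative shortly before; the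
    values 1 and -1 of [k] serve the two sides of Sigma. *)
Lemma sw_past_sign (k a t : R) (c : R -> plane) v : a < t ->
  derive_within `[a, t] c t v -> f (c t) = 0 ->
  0 < k * dot (grad f (c t)) v -> exists2 s, a <= s < t & k * f (c s) < 0.
Proof.
move=> at_ dc f0; set D := dot _ _ => kD.
have k0 : 0 < `|k| by rewrite normr_gt0; apply: contraTneq kD => ->; rewrite mul0r ltxx.
have e0 : 0 < k * D / `|k| / 2 by rewrite !divr_gt0.
have [d d0 h] := sw_chain_rule dc e0.
pose s := Num.max a (t - d / 2).
have sa : a <= s by rewrite /s le_max lexx.
have st : s < t by rewrite /s gt_max at_ /=; lra.
have sd : t - s < d.
  have : t - d / 2 <= s by rewrite /s le_max lexx orbT.
  by lra.
exists s; first by rewrite sa.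
have := h s; rewrite /= in_itv /= sa (ltW st) distrC gtr0_norm ?subr_gt0// => /(_ isT sd).
rewrite f0 subr0 -/D => H.
have : `|k * (f (c s) - (s - t) * D)| <= k * D / 2 * (t - s).
  rewrite normrM.
  have -> : k * D / 2 * (t - s) = `|k| * (k * D / `|k| / 2 * (t - s)).
    by field; rewrite gt_eqF.
  by rewrite ler_wpM2l.
rewrite ler_norml => /andP[_].
have -> : k * (f (c s) - (s - t) * D) = k * f (c s) + k * D * (t - s) by ring.
have : 0 < k * D * (t - s) by rewrite mulr_gt0// subr_gt0.
by lra.
Qed.

(** Since 0 is a regular value, a small move along plus or minus the gradient gives [f] either sign.
    The smoothness of [fX] and [fY], given near the closed regions, thereby becomes available on
    Sigma. *)
Lemma sigma_in_closures p : sigma Z p ->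
  closure (sigma_plus Z) p /\ closure (sigma_minus Z) p.
Proof.
move=> [dp fp]; set g := grad f p.
have g0 : 0 < dot g g by apply: dot_gt0; exact: sw_regular.
have n0 : 0 < `|g|.
  by rewrite normr_gt0; apply: contraTneq g0 => ->; rewrite /dot /= mulr0 addr0 ltxx.
have [d1 d10 h1] := (nbhs_dist _ _).1 (open_nbhs_nbhs (conj (@dom_open _ _ Z) dp)).
have e0 : 0 < dot g g / `|g| / 2 by rewrite !divr_gt0.
have [d2 d20 h2] := sw_strict_diff p e0.
suff H (k : R) : `|k| = 1 -> forall U, nbhs p U ->
    exists q, [/\ U q, dom Z q & 0 < k * f q].
  split=> U /H hU.
    have [q [Uq dq]] := hU 1 (normr1 _).
    by rewrite mul1r => fq; exists q; split.
  have [|q [Uq dq]] := hU (-1); first by rewrite normrN1.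
  by rewrite mulN1r oppr_gt0 => fq; exists q; split.
move=> k1 U /nbhs_dist[d3 d30 h3].
pose d := Num.min d1 (Num.min d2 d3).
have d0 : 0 < d by rewrite !lt_min d10 d20.
pose t := d / 2 / `|g|.
have t0 : 0 < t by rewrite !divr_gt0.
pose q := p + (k * t) *: g.
have qp : q - p = (k * t) *: g by rewrite /q addrC addKr.
have nqp : `|q - p| = d / 2.
  by rewrite qp normrZ normrM k1 mul1r (gtr0_norm t0) /t divfK ?gt_eqF.
have : `|q - p| < d by rewrite nqp; lra.
rewrite !lt_min => /and3P[q1 q2 q3].
exists q; split; [exact: h3|exact: h1|].
have := h2 p q; rewrite subrr normr0 => /(_ d20 q2).
rewrite fp subr0 qp dotZ normrZ normrM k1 mul1r (gtr0_norm t0).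
have -> : dot g g / `|g| / 2 * (t * `|g|) = t * dot g g / 2.
  by field; rewrite gt_eqF.
move=> H; have : `|k * (f q - k * t * dot g g)| <= t * dot g g / 2.
  by rewrite normrM k1 mul1r.
have kk : k * k = 1 by rewrite -expr2 -real_normK ?num_real// k1 expr1n.
have -> : k * (f q - k * t * dot g g) = k * f q - t * dot g g.
  by rewrite mulrBr !mulrA kk mul1r.
have : 0 < t * dot g g by rewrite mulr_gt0.
by rewrite ler_norml => ? /andP[+ _]; lra.
Qed.

Lemma field_continuous (V : plane -> plane) (A : set plane) p :
  (exists W, [/\ open W, A `<=` W & smooth_field_on W r V]) -> A p ->
  {for p, continuous V}.
Proof.
move=> [W [_ AW [s1 s2]]] /AW Wp.
apply/continuous_dist => e e0.
have /continuous_dist/(_ _ e0)[d1 d10 h1] := smooth_on_continuous s1 Wp.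
have /continuous_dist/(_ _ e0)[d2 d20 h2] := smooth_on_continuous s2 Wp.
exists (Num.min d1 d2); first by rewrite lt_min d10.
move=> q; rewrite lt_min => /andP[q1 q2].
by rewrite prod_normE gt_max; apply/andP; split; [exact: h1|exact: h2].
Qed.

Lemma lie_continuous (V : plane -> plane) p :
  {for p, continuous V} -> {for p, continuous (lie V f)}.
Proof.
move=> cV; have [_ c1 c2] := sw_partials.
apply: cvgD; apply: cvgM; first exact: c1.
- by apply: cvg_comp cV _; exact: cvg_fst.
- exact: c2.
- by apply: cvg_comp cV _; exact: cvg_snd.
Qed.

Lemma fX_continuous p : sigma Z p -> {for p, continuous (fX Z)}.
Proof. by move=> /sigma_in_closures[h _]; exact: field_continuous (fX_smooth Z) h. Qed.

Lemma fY_continuous p : sigma Z p -> {for p, continuous (fY Z)}.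
Proof. by move=> /sigma_in_closures[_ h]; exact: field_continuous (fY_smooth Z) h. Qed.

Lemma sliding_continuous p : sigma_e Z p -> {for p, continuous (sliding Z)}.
Proof.
move=> [sp X0 Y0].
have cX := fX_continuous sp; have cY := fY_continuous sp.
apply: cvgZ; last by apply: cvgB; apply: cvgZ => //; exact: lie_continuous.
apply: cvgV; first by rewrite lt_eqF//; lra.
by apply: cvgB; exact: lie_continuous.
Qed.

(** The filter defining the extension is not punctured, so at a point of [sigma_e] any limit must
    equal the value there. *)
Lemma sliding_extE p v : sigma_e Z p -> sliding_ext Z p v <-> v = sliding Z p.
Proof.
move=> sp; split=> [h|->]; last first.
  exact: cvg_within_filter (sliding_continuous sp).
apply/eqP; rewrite -subr_eq0 -normr_le0; apply/ler_addgt0Pl => e e0; rewrite addr0.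
have /cvgrPdist_lt/(_ _ e0) := h; rewrite near_withinE => /nbhs_dist[d d0 hd].
by apply/ltW/hd; [rewrite subrr normr0|right].
Qed.

Lemma sliding_tangent p : sigma_e Z p -> dot (grad f p) (sliding Z p) = 0.
Proof.
move=> _; rewrite /sliding dotZ dotB !dotZ -!/(lie _ _ _) -/(Xf _ _) -/(Yf _ _).
by rewrite [Yf Z p * _]mulrC subrr mulr0.
Qed.

Lemma closure_sigma A p : A `<=` sigma Z -> closure A p -> f p = 0.
Proof.
move=> sA cA; apply/eqP; rewrite -normr_le0; apply/ler_addgt0Pl => e e0; rewrite addr0.
have /continuous_dist/(_ _ e0)[d d0 hd] := @sw_continuous p.
have [q Aq qp] := closure_dist cA d0.
by have := hd _ qp; rewrite (sA _ Aq).2 sub0r normrN => /ltW.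
Qed.

Lemma closure_sigma_plus p : closure (sigma_plus Z) p -> 0 <= f p.
Proof.
move=> cA; rewrite leNgt; apply/negP => fp.
have fp' : 0 < - f p by rewrite oppr_gt0.
have /continuous_dist/(_ _ fp')[d d0 hd] := @sw_continuous p.
have [q [_ fq] qp] := closure_dist cA d0.
by have := hd _ qp; rewrite ltr_norml; lra.
Qed.

Lemma closure_sigma_minus p : closure (sigma_minus Z) p -> f p <= 0.
Proof.
move=> cA; rewrite leNgt; apply/negP => fp.
have /continuous_dist/(_ _ fp)[d d0 hd] := @sw_continuous p.
have [q [_ fq] qp] := closure_dist cA d0.
by have := hd _ qp; rewrite ltr_norml; lra.
Qed.

(** The empty set for [FlowS] makes membership in a [flow_region] select one of the two open
    sides. *)
Definition flow_region (m : flow) : set plane :=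
  match m with
  | FlowX => sigma_plus Z
  | FlowY => sigma_minus Z
  | FlowS => set0
  end.

Lemma follows_FlowS_sigma I c t : follows Z FlowS I c -> I t -> f (c t) = 0.
Proof.
move=> h /h[+ _] => -[]; apply: closure_sigma; by move=> q [].
Qed.

Lemma follows_region m m' I c t :
  follows Z m' I c -> I t -> flow_region m (c t) -> m' = m.
Proof.
case: m => // h It [_ ft]; case: m' h => h //; exfalso.
- by have := closure_sigma_minus (h _ It).1; rewrite leNgt ft.
- by have := follows_FlowS_sigma h It; lra.
- by have := closure_sigma_plus (h _ It).1; rewrite leNgt ft.
- by have := follows_FlowS_sigma h It; lra.
Qed.

(** On [sigma_e], X points into f > 0 and Y into f < 0. An arc of X ending there would have f < 0
    just before, outside the closure of [sigma_plus]; likewise for Y with the signs exchanged. *)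
Lemma follows_into_sigma_e m (a t : R) c : a < t ->
  follows Z m `[a, t] c -> sigma_e Z (c t) -> m = FlowS.
Proof.
move=> at_ h [[_ ft] X0 Y0].
have tI : `[a, t]%classic t by rewrite /= in_itv /= lexx ltW.
case: m h => // h; exfalso; have [_ [v vE dv]] := h _ tI; rewrite vE in dv.
  have [|s /andP[sa st]] := sw_past_sign (k := 1) at_ dv ft; first by rewrite mul1r.
  have sI : `[a, t]%classic s by rewrite /= in_itv /= sa ltW.
  by have := closure_sigma_plus (h _ sI).1; lra.
have [|s /andP[sa st]] := sw_past_sign (k := -1) at_ dv ft.
  by rewrite mulN1r oppr_gt0.
have sI : `[a, t]%classic s by rewrite /= in_itv /= sa ltW.
by have := closure_sigma_minus (h _ sI).1; lra.
Qed.

End LocalAnalysis.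

(** * Local pieces and their concatenations *)

Section Pieces.
Context {R : realType} {r : nat} (r_gt0 : (0 < r)%N) (Z : nsvf (R := R) r).
Local Notation plane := (R * R)%type.
Local Notation f := (sw Z).
Implicit Types (p q v : plane) (g c : R -> plane) (m : flow).

Lemma follows_sub m (I I' : set R) c :
  I' `<=` I -> follows Z m I c -> follows Z m I' c.
Proof.
by move=> s; case: m => h t I't; have [St [v Vv dv]] := h _ (s _ I't);
  split=> //; exists v => //; exact: derive_within_sub dv.
Qed.

Lemma eq_follows m (I : set R) c c' :
  (forall t, I t -> c t = c' t) -> follows Z m I c -> follows Z m I c'.
Proof.
by move=> s; case: m => h t It; have [St [v Vv dv]] := h _ It; rewrite -s//;
  split=> //; exists v => //; exact: eq_derive_within dv.
Qed.

Lemma follows_shift m (I : set R) c (a : R) :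
  follows Z m I c -> follows Z m [set t | I (a + t)] (fun t => c (a + t)).
Proof.
by case: m => h t It; have [St [v Vv dv]] := h _ It;
  split=> //; exists v => //; exact: (derive_within_shift dv).
Qed.

Lemma follows_unshift m (I : set R) c (a : R) :
  follows Z m I (fun t => c (a + t)) -> follows Z m [set t | I (t - a)] c.
Proof.
move=> /(@follows_shift _ _ _ (- a)) h.
apply: eq_follows (follows_sub _ h) => [t _ /=|t /=]; first by rewrite addrA subrr add0r.
by rewrite addrC.
Qed.

Lemma follows_cts m (I : set R) c t : follows Z m I c -> I t ->
  forall e : R, 0 < e -> exists2 d : R, 0 < d & forall s, I s -> `|s - t| < d ->
  `|c s - c t| < e.
Proof. by case: m => h It; have [_ [v _ dv]] := h _ It; exact: derive_within_cts dv. Qed.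

(** The five clauses of [local_clause] with separate past and future flows, put in one form so that
    case analyses on a piece have three branches. *)
Definition switches m1 m2 p := [\/ sigma_cplus Z p /\ (m1 = FlowY /\ m2 = FlowX),
  sigma_cminus Z p /\ (m1 = FlowX /\ m2 = FlowY), sigma_e Z p /\ m1 = FlowS |
  (sigma_s Z p /\ m2 = FlowS) \/ regular_tangency Z p].

(* [local_piece] with the time origin left in place. *)
Variant piece g (a s b : R) : Prop :=
| PieceWhole m of flow_region Z m (g s) & follows Z m `[a, b] g
| PieceSwitch m1 m2 of switches m1 m2 (g s) &
    follows Z m1 `[a, s] g & follows Z m2 `[s, b] g
| PieceConst of singular_tangency Z (g s) & forall t, a <= t <= b -> g t = g s.

Lemma local_pieceP g a b :
  local_piece Z g a b <-> exists2 s, a <= s <= b & piece g a s b.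
Proof.
split.
  move=> [s]; rewrite in_itv /= => sab [_ _ h]; exists s => //.
  have whole m : follows Z m `[a - s, b - s] (fun u => g (s + u)) -> follows Z m `[a, b] g.
    move=> /follows_unshift; apply: follows_sub => t /=; rewrite !in_itv /=.
    by move=> ?; lra.
  have pst m : follows Z m (past `[a - s, b - s]) (fun u => g (s + u)) ->
      follows Z m `[a, s] g.
    move=> /follows_unshift; apply: follows_sub => t /=; rewrite !in_itv /= => ?.
    by rewrite /past /= in_itv /=; split; lra.
  have fut m : follows Z m (future `[a - s, b - s]) (fun u => g (s + u)) ->
      follows Z m `[s, b] g.
    move=> /follows_unshift; apply: follows_sub => t /=; rewrite !in_itv /= => ?.
    by rewrite /future /= in_itv /=; split; lra.
  case: h; rewrite ?addr0.
  - by move=> h /whole; exact: PieceWhole.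
  - by move=> h /whole; exact: PieceWhole.
  - by move=> h /pst h1 /fut h2; apply: PieceSwitch h1 h2; constructor 1.
  - by move=> h /pst h1 /fut h2; apply: PieceSwitch h1 h2; constructor 2.
  - by move=> m h /pst h1 /fut h2; apply: PieceSwitch h1 h2; constructor 3.
  - by move=> m h /pst h1 /fut h2; apply: PieceSwitch h1 h2; constructor 4; left.
  - by move=> m1 m2 h /pst h1 /fut h2; apply: PieceSwitch h1 h2; constructor 4; right.
  - move=> h h'; apply: PieceConst => // t tab.
    have := h' (t - s); rewrite (_ : s + (t - s) = t); last by ring.
    by rewrite ?addr0 /= in_itv /=; apply; lra.
move=> [s sab h]; exists s; first by rewrite in_itv.
split; [exact: interval_is_interval|by rewrite /= in_itv /=; lra|].
have whole m : follows Z m `[a, b] g -> follows Z m `[a - s, b - s] (fun u => g (s + u)).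
  move=> /(follows_shift s); apply: follows_sub => t /=; rewrite !in_itv /=.
  by move=> ?; lra.
have pst m : follows Z m `[a, s] g ->
    follows Z m (past `[a - s, b - s]) (fun u => g (s + u)).
  move=> /(follows_shift s); apply: follows_sub => t; rewrite /past /= !in_itv /=.
  by move=> [? ?]; lra.
have fut m : follows Z m `[s, b] g ->
    follows Z m (future `[a - s, b - s]) (fun u => g (s + u)).
  move=> /(follows_shift s); apply: follows_sub => t; rewrite /future /= !in_itv /=.
  by move=> [? ?]; lra.
case: h.
- move=> m gs h0; have h := whole _ h0.
  by case: m gs h {h0} => //= gs h; [apply: LocalPlus h|apply: LocalMinus h]; rewrite addr0.
- move=> m1 m2 [[gs [-> ->]]|[gs [-> ->]]|[gs ->]|[[gs ->]|gs]] h10 h20;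
    have h1 := pst _ h10; have h2 := fut _ h20.
  + by apply: LocalCrossPlus h1 h2; rewrite addr0.
  + by apply: LocalCrossMinus h1 h2; rewrite addr0.
  + by apply: LocalEscaping h1 h2; rewrite addr0.
  + by apply: LocalSliding h1 h2; rewrite addr0.
  + by apply: LocalRegular h1 h2; rewrite addr0.
- move=> gs h; apply: LocalSingular; rewrite addr0// => t; rewrite /= in_itv /= => ?.
  by apply: h; lra.
Qed.

Lemma eq_local_piece g g' a b : (forall t, a <= t <= b -> g t = g' t) ->
  local_piece Z g a b -> local_piece Z g' a b.
Proof.
move=> E /local_pieceP[s sab h]; apply/local_pieceP; exists s => //.
case: h => [m gs h|m1 m2 gs h1 h2|gs h].
- apply: (PieceWhole (m := m)); first by rewrite -E.
  by apply: eq_follows h => t; rewrite /= in_itv /=; exact: E.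
- apply: (PieceSwitch (m1 := m1) (m2 := m2)); first by rewrite -E.
    by apply: eq_follows h1 => t; rewrite /= in_itv /= => ?; apply: E; lra.
  by apply: eq_follows h2 => t; rewrite /= in_itv /= => ?; apply: E; lra.
- apply: PieceConst; first by rewrite -E.
  by move=> t tab; rewrite -!E//; exact: h.
Qed.

Lemma local_piece_shift g a b (k : R) : local_piece Z g (k + a) (k + b) ->
  local_piece Z (fun t => g (k + t)) a b.
Proof.
move=> /local_pieceP[s sab h]; apply/local_pieceP; exists (s - k); first by lra.
have E x y m : follows Z m `[x, y] g -> follows Z m `[x - k, y - k] (fun t => g (k + t)).
  move=> /(follows_shift k); apply: follows_sub => t /=; rewrite !in_itv /=.
  by move=> ?; lra.
have ks : k + (s - k) = s by ring.
have ka (x : R) : k + x - k = x by ring.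
case: h => [m gs h|m1 m2 gs h1 h2|gs h].
- by apply: (PieceWhole (m := m)); rewrite ?ks//; have := E _ _ _ h; rewrite !ka.
- apply: (PieceSwitch (m1 := m1) (m2 := m2)); rewrite ?ks//.
    by have := E _ _ _ h1; rewrite ka.
  by have := E _ _ _ h2; rewrite ka.
- by apply: PieceConst; rewrite ks// => t ?; apply: h; lra.
Qed.

Lemma singular_not_sigma_e p : singular_tangency Z p -> sigma_e Z p -> False.
Proof. by move=> [_ [X0 _] _] [_ X1 _]; lra. Qed.

Lemma local_piece_future g a b t : local_piece Z g a b -> a <= t < b ->
  exists2 u, t < u <= b & (exists m, follows Z m `[t, u] g) \/
    (forall x, t <= x <= u -> g x = g t).
Proof.
move=> /local_pieceP[s sab h] tab; case: h => [m gs h|m1 m2 gs h1 h2|gs h].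
- exists b; first by lra.
  left; exists m; apply: follows_sub h => x /=; rewrite !in_itv /=; lra.
- have [st|ts] := leP s t.
    exists b; first by lra.
    by left; exists m2; apply: follows_sub h2 => x /=; rewrite !in_itv /=; lra.
  exists s; first by lra.
  by left; exists m1; apply: follows_sub h1 => x /=; rewrite !in_itv /=; lra.
- exists b; first by lra.
  by right=> x ?; rewrite (h x) ?(h t)//; lra.
Qed.

(** The singular tangency is recorded in the constant case because it excludes [sigma_e], where
    sliding is then the only way to arrive. *)
Lemma local_piece_past g a b t : local_piece Z g a b -> a < t <= b ->
  exists2 u, a <= u < t & (exists m, follows Z m `[u, t] g) \/
    (singular_tangency Z (g t) /\ forall x, u <= x <= t -> g x = g t).
Proof.
move=> /local_pieceP[s sab h] tab; case: h => [m gs h|m1 m2 gs h1 h2|gs h].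
- exists a; first by lra.
  left; exists m; apply: follows_sub h => x /=; rewrite !in_itv /=; lra.
- have [st|ts] := ltP s t.
    exists s; first by lra.
    by left; exists m2; apply: follows_sub h2 => x /=; rewrite !in_itv /=; lra.
  exists a; first by lra.
  by left; exists m1; apply: follows_sub h1 => x /=; rewrite !in_itv /=; lra.
- exists a; first by lra.
  right; split=> [|x ?]; last by rewrite (h x) ?(h t)//; lra.
  by rewrite h//; lra.
Qed.

Lemma local_piece_slides_back g a b t : local_piece Z g a b -> a < t <= b ->
  sigma_e Z (g t) -> exists2 u, a <= u < t & follows Z FlowS `[u, t] g.
Proof.
move=> h tab gt; have [u aut [[m hm]|[st _]]] := local_piece_past h tab; last first.
  by case: (singular_not_sigma_e st gt).
exists u => //; have ut : u < t by lra.
by rewrite -(follows_into_sigma_e r_gt0 ut hm gt).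
Qed.

(** The base point may lie after [t]. The curve then slides up to [t] by transversality, and [g t]
    becomes the base of a piece of escaping type. *)
Lemma local_piece_cut_right g a b t : local_piece Z g a b -> a < t <= b ->
  sigma_e Z (g t) -> local_piece Z g a t.
Proof.
move=> /local_pieceP[s sab h] tab gt; apply/local_pieceP.
have at_ : a < t by lra.
case: h => [m gs h|m1 m2 gs h1 h2|gs h].
- have h' : follows Z m `[a, t] g.
    by apply: follows_sub h => x /=; rewrite !in_itv /=; lra.
  by move: gs; rewrite (follows_into_sigma_e r_gt0 at_ h' gt).
- have [st|ts] := leP s t.
    exists s; first by lra.
    apply: (PieceSwitch gs h1); apply: follows_sub h2 => x /=; rewrite !in_itv /=; lra.
  have h' : follows Z m1 `[a, t] g.
    by apply: follows_sub h1 => x /=; rewrite !in_itv /=; lra.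
  have m1S := follows_into_sigma_e r_gt0 at_ h' gt; rewrite m1S in h'.
  exists t; first by lra.
  apply: (PieceSwitch (m1 := FlowS) (m2 := FlowS)) => //; first by constructor 3.
  by apply: follows_sub h' => x /=; rewrite !in_itv /=; lra.
- by case: (@singular_not_sigma_e (g t)) => //; rewrite h//; lra.
Qed.

(** The base point may lie before [t]. The flow after [t] is then forced by the open region it
    visits, and a point of that region is a new base. *)
Lemma local_piece_cut_left g a b t m (e : R) : local_piece Z g a b -> a <= t < b ->
  0 < e -> (forall x, t < x < t + e -> flow_region Z m (g x)) ->
  local_piece Z g t b.
Proof.
move=> /local_pieceP[s sab h] tab e0 gm; apply/local_pieceP.
pose x := t + Num.min e (b - t) / 2.
have mn : 0 < Num.min e (b - t) by rewrite lt_min e0; lra.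
have me : Num.min e (b - t) <= e by rewrite ge_min lexx.
have mb : Num.min e (b - t) <= b - t by rewrite ge_min lexx orbT.
have gx : flow_region Z m (g x) by apply: gm; rewrite /x; lra.
have xtb : t <= x <= b by rewrite /x; lra.
case: h => [m' gs h|m1 m2 gs h1 h2|gs h].
- have h' : follows Z m' `[t, b] g.
    by apply: follows_sub h => y /=; rewrite !in_itv /=; lra.
  exists x => //; apply: (PieceWhole (m := m')) => //.
  by rewrite (follows_region h' _ gx)//= in_itv.
- have [ts|st] := leP t s.
    exists s; first by lra.
    by apply: (PieceSwitch gs _ h2); apply: follows_sub h1 => y /=; rewrite !in_itv /=; lra.
  have h' : follows Z m2 `[t, b] g.
    by apply: follows_sub h2 => y /=; rewrite !in_itv /=; lra.
  exists x => //; apply: (PieceWhole (m := m2)) => //.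
  by rewrite (follows_region h' _ gx)//= in_itv.
- have ft : f (g x) = 0 by rewrite h; [case: gs => -[]|lra].
  by move: gx; case: (m) => //= -[_]; rewrite ft ltxx.
Qed.

Lemma local_piece_slide g a b : a <= b -> (forall t, a <= t <= b -> sigma_e Z (g t)) ->
  follows Z FlowS `[a, b] g -> local_piece Z g a b.
Proof.
move=> ab ge h; apply/local_pieceP; exists a; first by rewrite lexx.
apply: (PieceSwitch (m1 := FlowS) (m2 := FlowS)) => //.
  by constructor 3; split=> //; apply: ge; rewrite lexx.
by apply: follows_sub h => y /=; rewrite !in_itv /=; lra.
Qed.

(* The common lower bound [e] on the lengths of the pieces forces infinite
   concatenations of chains to be defined for all times. *)
Inductive chain (e : R) g : R -> R -> Prop :=
| ChainNil a : chain e g a a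
| ChainCons a b d : local_piece Z g a b -> a + e <= b -> chain e g b d -> chain e g a d.

Lemma chain_cat e g a b d : chain e g a b -> chain e g b d -> chain e g a d.
Proof. by elim=> // {}a a' {}b h1 h2 _ IH /IH; exact: ChainCons. Qed.

Lemma chain1 e g a b : local_piece Z g a b -> a + e <= b -> chain e g a b.
Proof. by move=> h1 h2; apply: ChainCons h1 h2 (ChainNil _ _ _). Qed.

Lemma chain_weaken e e' g a b : e' <= e -> chain e g a b -> chain e' g a b.
Proof.
move=> ee; elim=> [*|{}a a' {}b h1 h2 _ IH]; first exact: ChainNil.
by apply: ChainCons h1 _ IH; lra.
Qed.

Lemma chain_le e g a b : 0 < e -> chain e g a b -> a <= b.
Proof. by move=> e0; elim=> // {}a a' {}b h1 h2 _ IH; lra. Qed.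

Lemma eq_chain e g g' a b : 0 < e -> (forall t, a <= t <= b -> g t = g' t) ->
  chain e g a b -> chain e g' a b.
Proof.
move=> e0 E c; elim: c E => [?|{}a a' {}b h1 h2 c IH] E; first exact: ChainNil.
have := chain_le e0 c => a'b.
apply: (ChainCons _ h2); first by apply: eq_local_piece h1 => t ?; apply: E; lra.
by apply: IH => t ?; apply: E; lra.
Qed.

Lemma chain_shift e g a b (k : R) : chain e g (k + a) (k + b) ->
  chain e (fun t => g (k + t)) a b.
Proof.
move=> c; rewrite -[a](addKr k) -[b](addKr k).
elim: c => [*|x y z h1 h2 _ IH]; first exact: ChainNil.
apply: ChainCons IH; last by lra.
by apply: local_piece_shift; rewrite !addNKr.
Qed.

Lemma chain_piece_future e g a b t : 0 < e -> chain e g a b -> a <= t < b ->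
  exists a' b', local_piece Z g a' b' /\ a' <= t < b'.
Proof.
move=> e0; elim=> [?|x y z h1 h2 _ IH] tab; first by lra.
have [yt|ty] := leP y t; first by apply: IH; lra.
by exists x, y; split=> //; lra.
Qed.

Lemma chain_piece_past e g a b t : 0 < e -> chain e g a b -> a < t <= b ->
  exists a' b', local_piece Z g a' b' /\ a' < t <= b'.
Proof.
move=> e0; elim=> [?|x y z h1 h2 _ IH] tab; first by lra.
have [yt|ty] := ltP y t; first by apply: IH; lra.
by exists x, y; split=> //; lra.
Qed.

Lemma chain_right_cts e g a b t : 0 < e -> chain e g a b -> a <= t < b ->
  forall e : R, 0 < e -> exists2 d : R, 0 < d & forall s, t <= s < t + d ->
  `|g s - g t| < e.
Proof.
move=> e0 c /(chain_piece_future e0 c)[a' [b' [h tab]]] e' e'0.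
have [u tu [[m hm]|hc]] := local_piece_future h tab.
  have [|d d0 hd] := follows_cts (t := t) hm _ e'0; first by rewrite /= in_itv /=; lra.
  exists (Num.min d (u - t)); first by rewrite lt_min d0; lra.
  move=> s; rewrite -ltrBlDl lt_min => /and3P[ts sd su].
  by apply: hd; rewrite /= ?in_itv /= ?ger0_norm; lra.
exists (u - t); first by lra.
by move=> s ?; rewrite hc ?subrr ?normr0//; lra.
Qed.

Lemma chain_left_cts e g a b t : 0 < e -> chain e g a b -> a < t <= b ->
  forall e : R, 0 < e -> exists2 d : R, 0 < d & forall s, t - d < s <= t ->
  `|g s - g t| < e.
Proof.
move=> e0 c /(chain_piece_past e0 c)[a' [b' [h tab]]] e' e'0.
have [u tu [[m hm]|[_ hc]]] := local_piece_past h tab.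
  have [|d d0 hd] := follows_cts (t := t) hm _ e'0; first by rewrite /= in_itv /=; lra.
  exists (Num.min d (t - u)); first by rewrite lt_min d0; lra.
  move=> s; rewrite ltrBlDr -ltrBlDl lt_min => /andP[/andP[ts sd] su].
  by apply: hd; rewrite /= ?in_itv /= ?ler0_norm; lra.
exists (t - u); first by lra.
by move=> s ?; rewrite hc ?subrr ?normr0//; lra.
Qed.

Lemma chain_slides_back e g a b t : 0 < e -> chain e g a b -> a < t <= b ->
  sigma_e Z (g t) -> exists2 u, u < t & follows Z FlowS `[u, t] g.
Proof.
move=> e0 c /(chain_piece_past e0 c)[a' [b' [h tab]]] gt.
by have [u ? ?] := local_piece_slides_back h tab gt; exists u => //; lra.
Qed.

Lemma chain_cut_right e g a b t : 0 < e -> chain e g a b -> a < t <= b ->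
  sigma_e Z (g t) -> exists2 e', 0 < e' & chain e' g a t.
Proof.
move=> e0 + + gt; elim=> [?|x y z h1 h2 _ IH] tab; first by lra.
have [ty|yt] := leP t y.
  exists (t - x); first by lra.
  apply: chain1; last by lra.
  by apply: local_piece_cut_right h1 _ gt; lra.
have [|e' e'0 c] := IH; first by lra.
exists (Num.min e e'); first by rewrite lt_min e0.
apply: (ChainCons h1); first by apply: le_trans h2; rewrite lerD2l ge_min lexx.
by apply: chain_weaken c; rewrite ge_min lexx orbT.
Qed.

Lemma chain_cut_left e g a b t m (d : R) : 0 < e -> chain e g a b -> a <= t < b ->
  0 < d -> (forall x, t < x < t + d -> flow_region Z m (g x)) ->
  exists2 e', 0 < e' & chain e' g t b.
Proof.
move=> e0 + + d0 gm; elim=> [?|x y z h1 h2 c IH] tab; first by lra.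
have [yt|ty] := leP y t; first by apply: IH; lra.
exists (Num.min e (y - t)); first by rewrite lt_min e0; lra.
apply: (@ChainCons _ _ _ y).
- by apply: local_piece_cut_left h1 _ d0 gm; lra.
- have : Num.min e (y - t) <= y - t by rewrite ge_min lexx orbT.
  by lra.
- by apply: chain_weaken c; rewrite ge_min lexx.
Qed.

End Pieces.

(** * Finite stretches of a trajectory *)

Section Concatenations.
Context {R : realType} {r : nat} (Z : nsvf (R := R) r).

Lemma concatenation_chain N (t : int -> R) (g : R -> R * R) (i : int) (n : nat) :
  concatenation Z N t g ->
  (forall j, (j < n)%N -> N (i + j%:Z)) ->
  exists2 e, 0 < e & chain Z e g (t i) (t (i + n%:Z)).
Proof.
move=> cN; elim: n => [_|n IH hn].
  by exists 1 => //; rewrite addr0; exact: ChainNil.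
have [j jn|e e0 c] := IH; first by apply: hn; rewrite ltnS ltnW.
have [lt_t h] := cN _ (hn n (leqnn _)).
set t1 := t (i + n%:Z) in lt_t h c; set t2 := t _ in lt_t h.
exists (Num.min e (t2 - t1)); first by rewrite lt_min e0; lra.
have -> : i + n.+1%:Z = i + n%:Z + 1 by lia.
apply: chain_cat (_ : chain Z _ _ _ t1) _.
  by apply: chain_weaken c; rewrite ge_min lexx.
apply: chain1 h _.
have : Num.min e (t2 - t1) <= t2 - t1 by rewrite ge_min lexx orbT.
by lra.
Qed.

Lemma trajectory_chain D (g : R -> R * R) (a b : R) : trajectory Z D g -> D a -> D b -> a < b ->
  exists e a' b', [/\ 0 < e, chain Z e g a' b', a' <= a & b <= b'].
Proof.
move=> [N [t [Nint cN ->]]] [i Ni]; rewrite /= in_itv /= => ia [k Nk].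
rewrite /= in_itv /= => kb ab.
have [ik|ki] := leP i k.
  have [n kn] : exists n, k = i + n%:Z by exists `|k - i|%N; lia.
  have [j jn|e e0 c] := concatenation_chain (i := i) (n := n.+1) cN.
    by apply: (Nint i _ k) => //; lia.
  exists e, (t i), (t (k + 1)); split=> //; [|by lra|by lra].
  by have <- : i + n.+1%:Z = k + 1 by lia.
(* If the piece holding [b] preceded the piece holding [a], then [b <= t (k + 1) <= t i <= a],
   against [a < b]. *)
have [n kn] : exists n, i = k + n.+1%:Z by exists `|i - k|.-1%N; lia.
have [j jn|e e0 c] := concatenation_chain (i := k + 1) (n := n) cN.
  by apply: (Nint k _ i) => //; lia.
have := chain_le e0 c.
have -> : k + 1 + n%:Z = i by lia.
by lra.
Qed.

End Concatenations.

(** * Sliding along an arc *)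

Section Returns.
Context {R : realType} {r : nat} (r_gt0 : (0 < r)%N) (Z : nsvf (R := R) r).
Local Notation plane := (R * R)%type.
Local Notation f := (sw Z).
Implicit Types (p q v : plane) (g c : R -> plane) (m : flow) (a b s t u x y : R).

(** Quarter turn: [rot (grad f p)] directs the tangent of Sigma at [p]. *)
Definition rot v : plane := (v.2, - v.1).

Lemma rot_norm v : `|rot v| = `|v|.
Proof. by rewrite !prod_normE /= normrN maxC. Qed.

(** Cramer's rule for the linear forms [dot v'] and [dot (rot v)], with determinant [dot v v']. *)
Lemma frame_decomposition v v' w :
  dot v v' *: w = dot v' w *: v + dot (rot v) w *: rot v'.
Proof.
case: v v' w => [a b] [a' b'] [x y]; rewrite /dot /rot /=.
by apply: injective_projections; rewrite /= /GRing.scale /=; ring.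
Qed.

Lemma frame_bound v v' w : 0 < dot v v' ->
  `|w| <= (`|v| * `|dot v' w| + `|v'| * `|dot (rot v) w|) / dot v v'.
Proof.
move=> d0; rewrite ler_pdivlMr// mulrC -(gtr0_norm d0) -normrZ frame_decomposition.
by apply: le_trans (ler_normD _ _) _; rewrite !normrZ rot_norm lerD// mulrC.
Qed.

(** A substitute for the implicit function theorem. Between two zeros of [f], strict
    differentiability makes the normal component of [q' - q] account for at most half of its norm,
    so the tangential component controls the whole. *)
Lemma tangent_chart p : sigma Z p -> exists C d : R, [/\ 0 < C, 0 < d,
  forall q, `|q - p| < d -> 0 < dot (grad f p) (grad f q) &
  forall q q', `|q - p| < d -> `|q' - p| < d -> f q = 0 -> f q' = 0 ->
    `|q' - q| <= C * `|dot (rot (grad f p)) (q' - q)| ].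
Proof.
move=> [_ fp]; set n := grad f p.
have N0 : 0 < dot n n by apply: dot_gt0; exact: sw_regular.
have n0 : 0 < `|n|.
  by rewrite normr_gt0; apply: contraTneq N0 => ->; rewrite /dot /= mulr0 addr0 ltxx.
have e0 : 0 < dot n n / (2 * `|n|) by rewrite divr_gt0// mulr_gt0.
have [d1 d10 h1] := sw_strict_diff r_gt0 Z p e0.
have cn : {for p, continuous (fun q => dot n (grad f q))}.
  have [_ c1 c2] := sw_partials r_gt0 Z.
  by apply: cvgD; apply: cvgM; [exact: cvg_cst|exact: c1|exact: cvg_cst|exact: c2].
have /continuous_dist/(_ _ N0)[d2 d20 h2] := cn.
exists (2 * `|n| / dot n n), (Num.min d1 d2); split.
- by rewrite divr_gt0// mulr_gt0.
- by rewrite lt_min d10.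
- by move=> q; rewrite lt_min => /andP[_ /h2]; rewrite ltr_norml; lra.
move=> q q'; rewrite !lt_min => /andP[q1 _] /andP[q'1 _] fq fq'.
have := h1 _ _ q1 q'1; rewrite fq fq' subrr sub0r normrN -/n => H.
have := frame_bound (q' - q) N0; rewrite ler_pdivlMr// => H2.
have : `|n| * `|dot n (q' - q)| <= dot n n / 2 * `|q' - q|.
  have -> : dot n n / 2 * `|q' - q| = `|n| * (dot n n / (2 * `|n|) * `|q' - q|).
    by field; rewrite gt_eqF.
  by rewrite ler_wpM2l.
move=> H3; rewrite [leRHS]mulrAC ler_pdivlMr//.
by lra.
Qed.

Context (c : R -> plane) (J : set plane).
Context (c_cts : {within `[0, 1], continuous c}).
Context (c_inj : {in `[0, 1] &, injective c}).
Context (J_c : J = c @` [set` `[0, 1]]).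
Context (J_e : J `<=` sigma_e Z).

Lemma arc_dist x : 0 <= x <= 1 -> forall e : R, 0 < e -> exists2 d : R, 0 < d &
  forall y, 0 <= y <= 1 -> `|y - x| < d -> `|c y - c x| < e.
Proof.
move=> x01 e e0; have /subspace_continuousP/(_ x) := c_cts.
rewrite /= in_itv /= => /(_ x01)/cvgrPdist_lt/(_ _ e0).
rewrite near_withinE => /nbhs_dist[d d0 hd]; exists d => // y y01 yx.
by rewrite distrC; apply: hd; rewrite //= in_itv.
Qed.

Lemma arc_mem x : 0 <= x <= 1 -> J (c x).
Proof. by move=> x01; rewrite J_c; exists x; rewrite //= in_itv. Qed.

Lemma arc_dot_cts v a b : 0 <= a -> b <= 1 ->
  {within `[a, b], continuous (fun x => dot v (c x))}.
Proof.
move=> a0 b1; apply: within_continuousP => x xab e e0.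
have e'0 : 0 < e / (2 * (`|v| + 1)) by rewrite divr_gt0// mulr_gt0// ltr_wpDl.
have [|d d0 hd] := arc_dist (x := x) _ e'0; first by lra.
exists d => // y yab yx; rewrite -dotB; apply: le_lt_trans (dot_le _ _) _.
have := hd y _ yx; rewrite ltr_pdivlMr ?mulr_gt0 ?ltr_wpDl// => H.
apply: le_lt_trans (H _); last by lra.
rewrite mulrC ler_wpM2l// ler_wpM2l//; lra.
Qed.

Lemma arc_inj x y : 0 <= x <= 1 -> 0 <= y <= 1 -> c x = c y -> x = y.
Proof. by move=> x01 y01; apply: c_inj; rewrite in_itv. Qed.

(** Around an interior parameter the arc covers Sigma on both sides: the tangential coordinate is
    injective along the arc, hence takes a neighbourhood of values, and the chart identifies a point
    of Sigma near [c x] with the arc point of the same coordinate. *)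
Lemma slides_from_interior g u s x : u < s -> follows Z FlowS `[u, s] g ->
  0 < x < 1 -> g s = c x ->
  exists2 d : R, 0 < d & forall t, s - d < t <= s -> J (g t).
Proof.
move=> us hg x01 gs.
have x01' : 0 <= x <= 1 by lra.
have [sc _ _] := J_e (arc_mem x01').
have [C [d [C0 d0 _ chart]]] := tangent_chart sc.
set v := rot _ in chart; pose phi y := dot v (c y).
have f0 y : 0 <= y <= 1 -> f (c y) = 0 by move=> /arc_mem/J_e[[]].
have [k k0 hk] := arc_dist x01' d0.
pose l := Num.min (k / 2) (Num.min x (1 - x)).
have l0 : 0 < l by rewrite !lt_min; lra.
have lk : l <= k / 2 by rewrite ge_min lexx.
have lx : l <= x by rewrite !ge_min lexx orbT.
have lx1 : l <= 1 - x by rewrite !ge_min lexx !orbT.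
have box y : x - l <= y <= x + l -> `|c y - c x| < d.
  by move=> ?; apply: hk; rewrite ?ltr_norml; lra.
have phi_inj y y' : x - l <= y <= x + l -> x - l <= y' <= x + l -> phi y = phi y' -> y = y'.
  move=> yl yl' E; apply: arc_inj; [lra|lra|].
  have := chart _ _ (box _ yl') (box _ yl) (f0 _ _) (f0 _ _).
  rewrite dotB -!/(phi _) E subrr normr0 mulr0 => H.
  by apply/eqP; rewrite -subr_eq0 -normr_le0 H//; lra.
have phi_cts a b : x - l <= a -> b <= x + l -> {within `[a, b], continuous phi}.
  by move=> ? ?; apply: arc_dot_cts; lra.
have n1 : phi (x - l) != phi x.
  by apply/eqP => /phi_inj E; have := E _ _; lra.
have n2 : phi (x + l) != phi x.
  by apply/eqP => /phi_inj E; have := E _ _; lra.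
have n3 y y' : x - l <= y < x -> x < y' <= x + l -> phi y = phi y' -> False.
  by move=> ? ? /phi_inj E; have := E _ _; lra.
(* A continuous injective function has no interior extremum: if both end values were on the same
   side of [phi x], the one closer to [phi x] would be attained on each side of [x]. *)
have sep : phi (x - l) < phi x < phi (x + l) \/ phi (x + l) < phi x < phi (x - l).
  have A (k' : R) : k' != 0 -> k' * phi x < k' * phi (x - l) ->
      k' * phi x < k' * phi (x + l) -> False.
    move=> k'0 h1 h2.
    pose w := Num.min (k' * phi (x - l)) (k' * phi (x + l)).
    have w1 : k' * phi x < w by rewrite lt_min h1.
    have w2 : w <= k' * phi (x - l) by rewrite ge_min lexx.
    have w3 : w <= k' * phi (x + l) by rewrite ge_min lexx orbT.
    have ivt a b : x - l <= a -> a <= b -> b <= x + l ->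
        k' * phi a <= w <= k' * phi b \/ k' * phi b <= w <= k' * phi a ->
        exists2 y, a <= y <= b & k' * phi y = w.
      move=> ? ab ? ?; apply: (@IVT_sym _ (fun y => k' * phi y)) => // z.
      by apply: cvgM; [exact: cvg_cst|exact: phi_cts].
    have [||||y1 y1x E1] := ivt (x - l) x; [lra|lra|lra|by right; rewrite w2 ltW|].
    have [||||y2 y2x E2] := ivt x (x + l); [lra|lra|lra|by left; rewrite w3 ltW|].
    have y1n : y1 != x by apply: contraTneq w1 => e; rewrite -E1 e ltxx.
    have y2n : y2 != x by apply: contraTneq w1 => e; rewrite -E2 e ltxx.
    apply: (n3 y1 y2); [by rewrite lt_neqAle y1n; lra|by rewrite lt_neqAle eq_sym y2n; lra|].
    by apply: (mulfI k'0); rewrite E1 E2.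
  move: n1 n2; rewrite !neq_lt => /orP[a|a] /orP[b|b].
  - by exfalso; apply: (A (-1)); rewrite ?oppr_eq0 ?oner_eq0//; lra.
  - by left; rewrite a b.
  - by right; rewrite a b.
  - by exfalso; apply: (A 1); rewrite ?oner_eq0//; lra.
have sI : `[u, s]%classic s by rewrite /= in_itv /= lexx ltW.
(* Every value within [w] of [phi x] is the coordinate of an arc point; the next constants turn this
   into a condition on distances, through [dot_le]. *)
pose w := Num.min `|phi (x - l) - phi x| `|phi (x + l) - phi x|.
have w0 : 0 < w by rewrite lt_min !normr_gt0 !subr_eq0 n1 n2.
have v0 : 0 < 2 * (`|v| + 1) by rewrite mulr_gt0// ltr_wpDl.
have e0 : 0 < Num.min d (w / (2 * (`|v| + 1))) by rewrite lt_min d0 divr_gt0.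
have [d' d'0 hd'] := follows_cts hg sI e0.
exists (Num.min d' (s - u)); first by rewrite lt_min d'0; lra.
move=> t; rewrite ltrBlDr -ltrBlDl lt_min => /andP[/andP[td tu] ts].
have tI : `[u, s]%classic t by rewrite /= in_itv /=; lra.
have := hd' t tI; rewrite ler0_norm; last by lra.
rewrite opprB => /(_ td); rewrite lt_min gs => /andP[gd gw].
have phit : `|dot v (g t) - phi x| < w.
  rewrite /phi -dotB; apply: le_lt_trans (dot_le _ _) _.
  rewrite ltr_pdivlMr // in gw; apply: le_lt_trans gw.
  by rewrite mulrC ler_wpM2l// ler_wpM2l// lerDl.
have [y yl Ey] : exists2 y, x - l <= y <= x + l & phi y = dot v (g t).
  apply: IVT_sym; [lra|by apply: phi_cts; lra|].
  move: phit; rewrite lt_min; case: sep => /andP[s1 s2].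
    rewrite (ltr0_norm (x := phi (x - l) - _)) ?subr_lt0//.
    rewrite (gtr0_norm (x := phi (x + l) - _)) ?subr_gt0// !ltr_norml; lra.
  rewrite (gtr0_norm (x := phi (x - l) - _)) ?subr_gt0//.
  by rewrite (ltr0_norm (x := phi (x + l) - _)) ?subr_lt0// !ltr_norml; lra.
have -> : g t = c y.
  have := chart _ _ (box _ yl) gd (f0 _ _) (follows_FlowS_sigma hg tI).
  rewrite dotB -/(phi _) Ey subrr normr0 mulr0 => H.
  by apply/eqP; rewrite -subr_eq0 -normr_le0 H//; lra.
by apply: arc_mem; lra.
Qed.

End Returns.

(** * Sliding into the arc from an endpoint *)

Section Slides.
Context {R : realType} {r : nat} (r_gt0 : (0 < r)%N) (Z : nsvf (R := R) r).
Local Notation plane := (R * R)%type.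
Local Notation f := (sw Z).
Implicit Types (p q v : plane) (g c : R -> plane) (m : flow) (a b s t u x y : R).

Lemma frame_combination v v' (e1 e2 e : R) w : 0 < dot v v' -> 0 <= e ->
  `|dot v' w| <= e1 * e -> `|dot (rot v) w| <= e2 * e ->
  `|w| <= (`|v| * e1 + `|v'| * e2) / dot v v' * e.
Proof.
move=> d0 e0 h1 h2; apply: le_trans (frame_bound w d0) _.
rewrite [leRHS]mulrAC ler_pM2r ?invr_gt0// mulrDl -!mulrA.
by apply: lerD; apply: ler_wpM2l.
Qed.

Definition enters (J : set plane) g s := (exists2 u, u < s & follows Z FlowS `[u, s] g) /\
  forall d : R, 0 < d -> exists2 t, s - d < t < s & ~ J (g t).

Definition slides_inside (J : set plane) p := exists2 T : R, 0 < T & exists c' : R -> plane,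
  [/\ c' 0 = p, follows Z FlowS `[0, T] c' & forall t, 0 <= t <= T -> J (c' t)].

Context (c : R -> plane) (J : set plane).
Context (c_cts : {within `[0, 1], continuous c}).
Context (c_inj : {in `[0, 1] &, injective c}).
Context (J_c : J = c @` [set` `[0, 1]]).
Context (J_e : J `<=` sigma_e Z).

Lemma follows_const p (T : R) : sigma_e Z p -> sliding Z p = 0 ->
  follows Z FlowS `[0, T] (fun=> p).
Proof.
move=> pe p0 t _; split; first by right; exact: subset_closure.
exists 0; first exact/(sliding_extE r_gt0).
apply/derive_withinP => e e0; exists 1 => // s' _ _.
by rewrite subrr scaler0 subr0 normr0 mulr_ge0// ltW.
Qed.

(* The grad f component of the increments of a curve in Sigma is negligible, so
   one transversal coordinate determines its velocity. *)
Lemma follows_of_coordinate p v (C T : R) (c' : R -> plane) :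
  (forall t, 0 <= t <= T -> 0 < dot v (grad f (c' t))) ->
  (forall t, 0 <= t <= T -> sigma_e Z (c' t)) ->
  0 < C -> (forall s t, 0 <= s <= T -> 0 <= t <= T ->
    `|c' s - c' t| <= C * `|dot (rot v) (c' s) - dot (rot v) (c' t)|) ->
  (forall t, 0 <= t <= T -> forall e : R, 0 < e -> exists2 d : R, 0 < d &
      forall s, 0 <= s <= T -> `|s - t| < d ->
      `|dot (rot v) (c' s) - dot (rot v) (c' t) -
        dot (rot v) (sliding Z (c' t)) * (s - t)| <= e * `|s - t|) ->
  follows Z FlowS `[0, T] c'.
Proof.
move=> nn ce C0 lip der t; rewrite /= in_itv /= => tT.
have te := ce _ tT; split; first by right; exact: subset_closure.
set w := sliding Z (c' t).
exists w; first exact/(sliding_extE r_gt0).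
apply/derive_withinP => e e0; set n' := grad f (c' t).
have D0 := nn _ tT; rewrite -/n' in D0; set D := dot v n' in D0.
(* The hypothesis on the coordinate, taken with error 1, bounds its rate near [t] by the norm of [F]
   plus 1, so [L] is a Lipschitz constant of [c'] at [t]. Half of the allowed error then goes to
   each of the two components. *)
pose F := dot (rot v) w; pose L := C * (`|F| + 1).
have F1 : 0 < `|F| + 1 by rewrite ltr_wpDl.
have L0 : 0 < L by rewrite mulr_gt0.
have v1 : 0 < `|v| + 1 by rewrite ltr_wpDl.
have n1 : 0 < `|n'| + 1 by rewrite ltr_wpDl.
have a0 : 0 < e * D / 2 / (`|v| + 1) / L by rewrite !divr_gt0// mulr_gt0.
have b0 : 0 < e * D / 2 / (`|n'| + 1) by rewrite !divr_gt0// mulr_gt0.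
have [d1 d10 h1] := sw_strict_diff r_gt0 Z (c' t) a0.
have [d2 d20 h2] := der _ tT _ b0.
have [d3 d30 h3] := der _ tT _ ltr01.
exists (Num.min (d1 / L) (Num.min d2 d3)); first by rewrite !lt_min divr_gt0 ?d20.
move=> s; rewrite /= in_itv /= => sT; rewrite !lt_min => /and3P[sd1 sd2 sd3].
have cL : `|c' s - c' t| <= L * `|s - t|.
  apply: le_trans (lip _ _ sT tT) _; rewrite -mulrA ler_wpM2l//; first exact: ltW.
  have := h3 _ sT sd3; rewrite mul1r -/w -/F => H.
  have tri (x y : R) : `|x| <= `|y| + `|x - y| by rewrite addrC -{1}(subrK y x) ler_normD.
  by apply: le_trans (tri _ (F * (s - t))) _; rewrite normrM [leRHS]mulrDl mul1r lerD2l.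
have cd : `|c' s - c' t| < d1.
  by apply: le_lt_trans cL _; rewrite mulrC -ltr_pdivlMr.
have E1 : `|dot n' (c' s - c' t - (s - t) *: w)| <= e * D / 2 / (`|v| + 1) * `|s - t|.
  rewrite (dotB n' (c' s - c' t)) dotZ sliding_tangent// mulr0 subr0.
  have := h1 (c' t) (c' s); rewrite subrr normr0 => /(_ d10 cd).
  have [[_ ->] _ _] := te; have [[_ ->] _ _] := ce _ sT.
  rewrite subrr sub0r normrN => /le_trans; apply.
  have -> : e * D / 2 / (`|v| + 1) * `|s - t| = e * D / 2 / (`|v| + 1) / L * (L * `|s - t|).
    by rewrite [RHS]mulrA divfK// gt_eqF.
  by rewrite ler_wpM2l// ltW.
have E2 : `|dot (rot v) (c' s - c' t - (s - t) *: w)| <= e * D / 2 / (`|n'| + 1) * `|s - t|.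
  by rewrite !dotB dotZ -/F mulrC h2.
apply: le_trans (frame_combination D0 _ E1 E2) _ => //.
rewrite ler_wpM2r// ler_pdivrMr// -/D.
have H (x z : R) : 0 <= x -> 0 <= z -> x * (z / (x + 1)) <= z.
  move=> x0 z0; rewrite mulrA ler_pdivrMr; last by lra.
  by rewrite mulrC ler_wpM2l//; lra.
have z0 : 0 <= e * D / 2 by rewrite divr_ge0// mulr_ge0// ltW.
have := H `|v| _ (normr_ge0 _) z0; have := H `|n'| _ (normr_ge0 _) z0.
by lra.
Qed.

(** A curve reaching [c 0] with a velocity that points out of the arc would come from inside J,
    against [enters]. So the sliding field vanishes at [c 0], and one may rest there, or it points
    inwards, and separation of variables produces the slide. *)
Lemma slide_of_enters g s : enters J g s -> g s = c 0 -> slides_inside J (c 0).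
Proof.
move=> [[u us hg] ent] gs; set p := c 0 in gs *.
have z01 : 0 <= (0 : R) <= 1 by rewrite lexx ler01.
have Jp : J p := arc_mem J_c z01.
have pe := J_e Jp; have [sp _ _] := pe.
have [C [d [C0 d0 nn chart]]] := tangent_chart r_gt0 sp.
set n := grad f p in nn chart.
have f0 y : 0 <= y <= 1 -> f (c y) = 0 by move=> /(arc_mem J_c)/J_e[[]].
have sI : `[u, s]%classic s by rewrite /= in_itv /= lexx ltW.
have [k k0 hk] := arc_dist c_cts z01 d0.
pose l := Num.min (k / 2) 1.
have l0 : 0 < l by rewrite !lt_min ltr01 andbT; lra.
have lk : l <= k / 2 by rewrite ge_min lexx.
have l1 : l <= 1 by rewrite !ge_min lexx orbT.
have box y : 0 <= y <= l -> `|c y - p| < d.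
  by move=> ?; apply: hk; rewrite ?ltr_norml; lra.
have phi_cts : {within `[0, l], continuous (fun x => dot (rot n) (c x))}.
  exact: (arc_dot_cts c_cts).
(* The sign [k'] orients the tangential coordinate so that it increases from [c 0] to [c l]. *)
have [k' kk' vlt] : exists2 k' : R, k' * k' = 1 &
    k' * dot (rot n) (c 0) < k' * dot (rot n) (c l).
  have n1 : dot (rot n) (c 0) != dot (rot n) (c l).
    apply/eqP => E; suff : c l = c 0 by move=> /(arc_inj c_inj) => H; have := H _ _; lra.
    have := chart _ _ (box 0 _) (box l _) (f0 _ _) (f0 _ _).
    rewrite dotB E subrr normr0 mulr0 => H.
    by apply/eqP; rewrite -subr_eq0 -normr_le0 H//; lra.
  move: n1; rewrite neq_lt => /orP[h|h]; first by exists 1; rewrite ?mul1r.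
  by exists (-1); rewrite ?mulN1r ?opprK// ltrN2.
have k'1 : `|k'| = 1.
  by apply/eqP; rewrite -sqrp_eq1// real_normK ?num_real// expr2 kk'.
pose phi q := k' * dot (rot n) q.
have phiB q q' : phi q - phi q' = k' * dot (rot n) (q - q').
  by rewrite /phi dotB mulrBr.
have phi_norm q : `|phi q| <= 2 * `|n| * `|q|.
  by rewrite normrM k'1 mul1r (le_trans (dot_le _ _))// rot_norm.
have phi_le q q' : `|phi q - phi q'| <= 2 * `|n| * `|q - q'|.
  by rewrite phiB; exact: phi_norm.
have {}chart q q' : `|q - p| < d -> `|q' - p| < d -> f q = 0 -> f q' = 0 ->
    `|q' - q| <= C * `|phi q' - phi q|.
  by move=> *; rewrite phiB normrM k'1 mul1r chart.
have ivt a : phi p <= a <= phi (c l) -> exists2 x, 0 <= x <= l & phi (c x) = a.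
  move=> H; apply: (@IVT_sym _ (fun x => phi (c x))); [exact: ltW| |by left].
  by move=> z; apply: cvgM; [exact: cvg_cst|exact: phi_cts].
have [w0|w0] := eqVneq (sliding Z p) 0.
  by exists 1 => //; exists (fun=> p); split=> //; exact: follows_const.
set w := sliding Z p in w0.
have [w' wE dg] : exists2 w', w' = w & derive_within `[u, s] g s w'.
  by have [_ [w' + dw]] := hg _ sI; rewrite gs => /(sliding_extE r_gt0 _ pe) E; exists w'.
have D0 : 0 < dot n n by apply: nn; rewrite subrr normr0.
have F0 : 0 < phi w.
  have Fn0 : phi w != 0.
    apply: contraNneq w0 => F0; have := frame_bound w D0; rewrite (sliding_tangent pe).
    have -> : dot (rot n) w = k' * phi w by rewrite /phi mulrA kk' mul1r.
    by rewrite F0 mulr0 normr0 !mulr0 addr0 mul0r normr_le0.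
  (* Outward velocity: for [t] shortly before [s], [P1] puts the coordinate of [g t] above that of
     [p] and [P2] below that of [c l], so [g t] lies on the arc, against [ent]. *)
  rewrite lt_neqAle eq_sym Fn0 leNgt; apply/negP => F0.
  pose e := - phi w / (4 * (`|n| + 1)).
  have e0 : 0 < e by rewrite divr_gt0 ?oppr_gt0// mulr_gt0// ltr_wpDl.
  have [d1 d10 h1] := (derive_withinP _ _ _ _).1 dg _ e0.
  pose e' := Num.min d ((phi (c l) - phi p) / (2 * (`|n| + 1))).
  have e'0 : 0 < e'.
    by rewrite lt_min d0 divr_gt0 ?subr_gt0// mulr_gt0// ltr_wpDl.
  have [d2 d20 h2] := derive_within_cts dg e'0.
  have d120 : 0 < Num.min (Num.min d1 d2) (s - u).
    by rewrite !lt_min d10 d20 subr_gt0.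
  have [t tw nJ] := ent _ d120; apply: nJ.
  have st0 : 0 < s - t by lra.
  have tsE : `|t - s| = s - t by rewrite distrC gtr0_norm.
  have : s - t < Num.min (Num.min d1 d2) (s - u) by lra.
  rewrite !lt_min -!andbA => /and3P[sd1 sd2 sdu].
  have tI : `[u, s]%classic t by rewrite /= in_itv /=; lra.
  have ft := follows_FlowS_sigma hg tI.
  have H1 := h1 _ tI; rewrite tsE wE gs in H1.
  have H2 := h2 _ tI; rewrite tsE gs in H2.
  have := H2 sd2; rewrite lt_min => /andP[gd ge].
  have {H1 sd1} H1 := H1 sd1.
  have P1 : `|phi (g t) - phi p + (s - t) * phi w| <= - phi w / 2 * (s - t).
    have -> : phi (g t) - phi p + (s - t) * phi w = phi (g t - p - (t - s) *: w).
      by rewrite /phi (dotB _ (g t - p)) dotB (dotZ _ (t - s)); ring.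
    apply: le_trans (phi_norm _) _.
    apply: le_trans (_ : 2 * `|n| * (e * (s - t)) <= _); first by rewrite ler_wpM2l// mulr_ge0.
    rewrite mulrA ler_wpM2r//; first exact: ltW.
    rewrite /e mulrA ler_pdivrMr ?mulr_gt0 ?ltr_wpDl//.
    by move: F0; have := normr_ge0 n; nra.
  have P2 : `|phi (g t) - phi p| < phi (c l) - phi p.
    apply: le_lt_trans (phi_le _ _) _.
    have n1 : 0 < 2 * (`|n| + 1) by rewrite mulr_gt0// ltr_wpDl.
    rewrite ltr_pdivlMr// in ge.
    by apply: le_lt_trans ge; rewrite mulrC ler_wpM2l// ler_wpM2l// lerDl.
  have [x xl Ex] : exists2 x, 0 <= x <= l & phi (c x) = phi (g t).
    apply: ivt; move: P1 P2; rewrite ler_norml ltr_norml.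
    have : (s - t) * phi w < 0 by rewrite pmulr_rlt0.
    by lra.
  have -> : g t = c x.
    have := chart _ _ (box _ xl) gd (f0 _ _) ft; rewrite Ex subrr normr0 mulr0 => H.
    by apply/eqP; rewrite -subr_eq0 -normr_le0 H//; lra.
  by apply: (arc_mem J_c); lra.
(* The arc is reparametrized by its tangential coordinate: [q a] is the arc point at coordinate [a].
   The parameter 0 is a default outside the range. *)
have thP a : exists x, phi p <= a <= phi (c l) -> 0 <= x <= l /\ phi (c x) = a.
  by have [/ivt[x ? ?]|na] := pselect (phi p <= a <= phi (c l)); [exists x|exists 0].
have [th hth] := choice thP; pose q a := c (th a).
have q_box a : phi p <= a <= phi (c l) -> `|q a - p| < d by move=> /hth[/box].
have q_phi a : phi p <= a <= phi (c l) -> phi (q a) = a by move=> /hth[].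
have q_J a : phi p <= a <= phi (c l) -> J (q a).
  by move=> /hth[? _]; apply: (arc_mem J_c); lra.
have q_f a : phi p <= a <= phi (c l) -> f (q a) = 0 by move=> /q_J/J_e[[]].
have q_lip a b : phi p <= a <= phi (c l) -> phi p <= b <= phi (c l) ->
    `|q b - q a| <= C * `|b - a|.
  move=> ha hb; have := chart _ _ (q_box _ ha) (q_box _ hb) (q_f _ ha) (q_f _ hb).
  by rewrite !q_phi.
pose F a := phi (sliding Z (q a)).
have F_cts a : phi p <= a <= phi (c l) -> forall e : R, 0 < e -> exists2 d : R, 0 < d &
    forall b, phi p <= b <= phi (c l) -> `|b - a| < d -> `|F b - F a| < e.
  move=> ha e e0; have e'0 : 0 < e / (2 * (`|n| + 1)).
    by rewrite divr_gt0// mulr_gt0// ltr_wpDl.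
  have /continuous_dist/(_ _ e'0)[d1 d10 h1] := sliding_continuous r_gt0 (J_e (q_J _ ha)).
  exists (d1 / C); first by rewrite divr_gt0.
  move=> b hb; rewrite ltr_pdivlMr// mulrC => ab.
  have := h1 _ (le_lt_trans (q_lip _ _ ha hb) ab).
  rewrite ltr_pdivlMr ?mulr_gt0 ?ltr_wpDl// => H.
  apply: le_lt_trans (phi_le _ _) _; apply: le_lt_trans H.
  by rewrite mulrC ler_wpM2l// ler_wpM2l// lerDl.
have pp : phi p <= phi p <= phi (c l) by rewrite lexx ltW.
have qp : q (phi p) = p.
  have := chart _ _ _ (q_box _ pp) (f0 0 z01) (q_f _ pp).
  rewrite subrr normr0 => /(_ d0); rewrite q_phi// subrr normr0 mulr0 normr_le0 subr_eq0.
  by move=> /eqP.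
have F0' : 0 < F (phi p) by rewrite /F qp.
have [d1 d10 h1] := F_cts _ pp _ F0'.
(* On [[phi p, ub]] the speed [F] differs from [F (phi p)] by less than [F (phi p)], so it stays
   positive. *)
pose ub := Num.min (phi (c l)) (phi p + d1 / 2).
have ub1 : phi p < ub by rewrite lt_min vlt /=; lra.
have ub2 : ub <= phi (c l) by rewrite ge_min lexx.
have ub3 : ub <= phi p + d1 / 2 by rewrite ge_min lexx orbT.
have sub a : phi p <= a <= ub -> phi p <= a <= phi (c l) by lra.
have [||T T0 [y [y0 yab dy]]] := @autonomous_ode _ F (phi p) ub ub1.
- move=> a /sub ha e /(F_cts _ ha)[d2 d20 h2]; exists d2 => // b /sub; exact: h2.
- move=> a ha; have := h1 _ (sub _ ha); rewrite (ger0_norm (x := a - _)); last by lra.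
  have ad : a - phi p < d1 by lra.
  by move=> /(_ ad); rewrite ltr_norml => /andP[+ _]; lra.
exists T => //; exists (q \o y); split=> [|| t /yab/sub/q_J//].
  by rewrite /= y0.
apply: (@follows_of_coordinate p n C).
- by move=> t /yab/sub/q_box/nn.
- by move=> t /yab/sub/q_J/J_e.
- by [].
- move=> s' t /yab/sub hs /yab/sub ht; rewrite /= -dotB -[`|dot _ _|]mul1r -k'1 -normrM -phiB.
  by rewrite !q_phi// q_lip.
move=> t tT e e0; have [d2 d20 h2] := dy _ tT _ e0; exists d2 => // s' sT st.
have := h2 _ sT st; have := sub _ (yab _ sT); have := sub _ (yab _ tT) => ht hs.
rewrite -{1}(q_phi _ hs) -{1}(q_phi _ ht) phiB /F /phi -mulrA -mulrBr normrM k'1 mul1r.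
by rewrite dotB.
Qed.

End Slides.

(** * Returning to an arc of the escaping region *)

Section ReturnToEndpoint.
Context {R : realType} {r : nat} (r_gt0 : (0 < r)%N) (Z : nsvf (R := R) r).
Local Notation plane := (R * R)%type.
Local Notation f := (sw Z).
Implicit Types (p q v : plane) (g c : R -> plane) (m : flow) (a b s t u x y : R).

Context (c : R -> plane) (J : set plane).
Context (c_cts : {within `[0, 1], continuous c}).
Context (c_inj : {in `[0, 1] &, injective c}).
Context (J_c : J = c @` [set` `[0, 1]]).
Context (J_e : J `<=` sigma_e Z).

(** Reversing the parameter reduces the endpoint [c 1] to the case of [c 0]. *)
Lemma arc_rev_cts : {within `[0, 1], continuous (fun x => c (1 - x))}.
Proof.
apply/subspace_continuousP => x; rewrite /= in_itv /= => x01.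
apply/cvgrPdist_lt => e e0.
have x01' : 0 <= 1 - x <= 1 by lra.
have [d d0 hd] := arc_dist c_cts x01' e0.
rewrite near_withinE; apply/nbhs_dist; exists d => // y yx; rewrite /= in_itv /= => y01.
rewrite distrC; apply: hd; first by lra.
by rewrite (_ : 1 - y - (1 - x) = - (y - x)) ?normrN//; ring.
Qed.

Lemma arc_rev_inj : {in `[0, 1] &, injective (fun x => c (1 - x))}.
Proof.
move=> x y; rewrite !in_itv /= => x01 y01 E.
have : 1 - x = 1 - y by apply: (arc_inj c_inj) E; lra.
by lra.
Qed.

Lemma arc_rev_image : J = (fun x => c (1 - x)) @` [set` `[0, 1]].
Proof.
rewrite J_c; apply/seteqP; split=> _ [x + <-]; rewrite /= in_itv /= => x01.
  by exists (1 - x); [rewrite /= in_itv /=; lra|rewrite subKr].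
by exists (1 - x); rewrite //= in_itv /=; lra.
Qed.

Lemma slide_of_enters_endpoint g s : enters Z J g s -> g s = c 0 \/ g s = c 1 ->
  slides_inside Z J (g s).
Proof.
move=> ent [gs|gs]; rewrite gs.
  exact: (slide_of_enters r_gt0 c_cts c_inj J_c J_e ent gs).
have E : c 1 = (fun x => c (1 - x)) 0 by rewrite subr0.
rewrite E in gs *.
exact: (slide_of_enters r_gt0 arc_rev_cts arc_rev_inj arc_rev_image J_e ent gs).
Qed.

Lemma arc_closed : closed J.
Proof.
rewrite J_c; apply: compact_closed; first exact: norm_hausdorff.
by apply: continuous_compact => //; exact: segment_compact.
Qed.

(** The return is placed at the start [s'] of the stay in J that lasts until [s2]. Outside points
    occur at times arbitrarily close before [s'], so the curve enters J there, and
    [slides_from_interior] leaves only the endpoints. *)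
Lemma return_to_endpoint K m p : J p ->
  escapes_and_returns Z J (sigma_e Z `&` K) (flow_region Z m) p ->
  exists e L g, [/\ 0 < e, 0 < L, chain Z e g 0 L, g 0 = p &
    exists2 d : R, 0 < d & forall t, 0 < t < d -> flow_region Z m (g t)] /\
    ((g L = c 0 \/ g L = c 1) /\ slides_inside Z J (g L)).
Proof.
move=> Jp [D [g [s0 [tg gs0 [D0 _ [s1 s01 esc]] [s2 [s02 D2 J2]]]]]].
have {}esc t : s0 < t < s1 -> flow_region Z m (g t) by move=> /esc[].
have [e [a [b [e0 ch a0 b2]]]] := trajectory_chain tg D0 D2 s02.
have s10 : 0 < s1 - s0 by rewrite subr_gt0.
have [||e' e'0 {ch}ch] := chain_cut_left (t := s0) (m := m) e0 ch _ s10; first by lra.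
  by move=> t ?; apply: esc; lra.
have outJ t : s0 < t < s1 -> ~ J (g t).
  by move=> /esc; case: (m) => //= -[_ ft] /J_e[[_ f0] _ _]; move: ft; rewrite f0 ltxx.
pose B := [set s | s0 <= s <= s2 /\ forall t, s <= t <= s2 -> J (g t)].
have B2 : B s2.
  split=> [|t]; first by lra.
  by rewrite -eq_le => /eqP <-.
have B1 : lbound B s1.
  move=> s [ss hs]; rewrite leNgt; apply/negP => ss1.
  pose t := Num.min ((s + s1) / 2) s2.
  have t1 : s0 < t by rewrite lt_min s02 andbT; lra.
  have t2 : t <= (s + s1) / 2 by rewrite ge_min lexx.
  have t3 : t <= s2 by rewrite ge_min lexx orbT.
  have t4 : s <= t by rewrite le_min; apply/andP; split; lra.
  by apply: (outJ t); [lra|apply: hs; lra].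
pose s' := inf B.
have infB : has_inf B by split; [exists s2|exists s1].
have s'1 : s1 <= s' by apply: lb_le_inf => //; exists s2.
have s'2 : s' <= s2 by apply: ge_inf => //; exists s1.
have Jr t : s' < t <= s2 -> J (g t).
  move=> /andP[st t2]; have d0 : 0 < t - s' by rewrite subr_gt0.
  have [s [_ hs] ss] := inf_adherent d0 infB.
  by apply: hs; rewrite t2 andbT -/s' in ss *; lra.
(* The stay includes its starting time because J is closed and [g] is right continuous. *)
have Js' : J (g s').
  have [->//|ne] := eqVneq s' s2; apply: contrapT => nJ.
  have : nbhs (g s') (~` J).
    by apply: open_nbhs_nbhs; split=> //; apply: closed_openC; exact: arc_closed.
  move=> /nbhs_dist[d d0 hd].
  have s's2 : s' < s2 by rewrite lt_neqAle ne.
  have [|k k0 hk] := chain_right_cts (t := s') e'0 ch _ d0; first by lra.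
  pose l := Num.min (k / 2) (s2 - s').
  have l0 : 0 < l by rewrite lt_min; lra.
  have lk : l <= k / 2 by rewrite ge_min lexx.
  have ls : l <= s2 - s' by rewrite ge_min lexx orbT.
  by apply: (hd (g (s' + l))); [apply: hk; lra|apply: Jr; lra].
have es' := J_e Js'.
have [|u us hu] := chain_slides_back r_gt0 (t := s') e'0 ch _ es'; first by lra.
have nJ (d : R) : 0 < d -> exists2 t, s' - d < t < s' & ~ J (g t).
  move=> d0; apply: contrapT => hn.
  have hJ t : s' - d < t < s' -> J (g t).
    by move=> tt; apply: contrapT => nJ; apply: hn; exists t.
  pose l := Num.min (d / 2) (s' - s0).
  have l0 : 0 < l by rewrite lt_min; lra.
  have ld : l <= d / 2 by rewrite ge_min lexx.
  have ls : l <= s' - s0 by rewrite ge_min lexx orbT.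
  have : B (s' - l).
    split; first by lra.
    move=> t tt; have [ts|st] := ltP t s'; first by apply: hJ; lra.
    by have [<-//|ne] := eqVneq s' t; apply: Jr; rewrite lt_neqAle ne st; lra.
  by move=> /(ge_inf (proj2 infB)); rewrite -/s'; lra.
have ent : enters Z J g s' by split=> //; exists u.
have [x x01 gx] : exists2 x, 0 <= x <= 1 & g s' = c x.
  by move: Js'; rewrite J_c => -[x +] <-; rewrite /= in_itv /= => ?; exists x.
have endp : g s' = c 0 \/ g s' = c 1.
  have [x0|x0] := eqVneq x 0; first by left; rewrite gx x0.
  have [x1|x1] := eqVneq x 1; first by right; rewrite gx x1.
  have x01' : 0 < x < 1 by rewrite lt_neqAle eq_sym x0 lt_neqAle x1; lra.
  have [d d0 hd] := slides_from_interior r_gt0 c_cts c_inj J_c J_e us hu x01' gx.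
  have [t tt nJt] := nJ _ d0; case: nJt; apply: hd; lra.
have [|e2 e20 {ch}ch] := chain_cut_right r_gt0 (t := s') e'0 ch _ es'; first by lra.
have L : s0 + (s' - s0) = s' by ring.
exists e2, (s' - s0), (fun t => g (s0 + t)); rewrite addr0 L; split.
  split=> //; [by lra|by apply: chain_shift; rewrite addr0 L|].
  by exists (s1 - s0) => // t ?; apply: esc; lra.
by split=> //; exact: slide_of_enters_endpoint.
Qed.

End ReturnToEndpoint.

(** * Loops *)

Section Excursions.
Context {R : realType} {r : nat} (Z : nsvf (R := R) r).
Local Notation plane := (R * R)%type.
Local Notation f := (sw Z).
Implicit Types (p q : plane) (g : R -> plane) (a b s t x y L : R).

Definition splice s g g' : R -> plane := fun t => if t <= s then g t else g' (t - s).

Lemma chain_splice e e' s L g g' : 0 < e -> 0 < e' -> g s = g' 0 ->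
  chain Z e g 0 s -> chain Z e' g' 0 L ->
  chain Z (Num.min e e') (splice s g g') 0 (s + L).
Proof.
move=> e0 e'0 E c c'.
have m1 : Num.min e e' <= e by rewrite ge_min lexx.
have m2 : Num.min e e' <= e' by rewrite ge_min lexx orbT.
have m0 : 0 < Num.min e e' by rewrite lt_min e0.
apply: (chain_cat (b := s)).
  apply: eq_chain m0 _ (chain_weaken m1 c) => t /andP[_ ts].
  by rewrite /splice ts.
apply: (eq_chain (g := fun t => g' (- s + t)) m0).
  move=> t /andP[st _]; rewrite /splice; case: leP => ts; last by rewrite addrC.
  have -> : t = s by apply/eqP; rewrite eq_le ts.
  by rewrite E addNr.
by apply: (chain_shift (k := - s)); rewrite addNr addKr; exact: chain_weaken c'.
Qed.

(* The values of f up to tau and just after tau are what distinguishes two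
   excursions with different exit times. *)
Definition excursion p q (tau L : R) g :=
  [/\ 0 < tau < L, exists2 e, 0 < e & chain Z e g 0 L, g 0 = p /\ g L = q,
     forall t, 0 <= t <= tau -> f (g t) = 0 &
     exists2 d : R, 0 < d & forall t, tau < t < tau + d -> f (g t) != 0].

Lemma excursion_splice p q q' tau tau' L L' g g' :
  excursion p q tau L g -> excursion q q' tau' L' g' ->
  excursion p q' tau (L + L') (splice L g g').
Proof.
move=> [tauL [e e0 c] [g0 gL] gf [d d0 hd]].
move=> [tauL' [e' e'0 c'] [g0' gL'] _ _]; split.
- by lra.
- exists (Num.min e e'); first by rewrite lt_min e0.
  by apply: chain_splice => //; rewrite gL g0'.
- split; first by rewrite /splice (_ : 0 <= L)//; lra.
  by rewrite /splice leNgt (_ : L < L + L') /=; [rewrite addrC addKr|lra].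
- by move=> t ht; rewrite /splice (_ : t <= L) ?gf//; lra.
- exists (Num.min d (L - tau)); first by rewrite lt_min d0; lra.
  have m1 : Num.min d (L - tau) <= d by rewrite ge_min lexx.
  have m2 : Num.min d (L - tau) <= L - tau by rewrite ge_min lexx orbT.
  by move=> t ht; rewrite /splice (_ : t <= L) ?hd//; lra.
Qed.

Definition exit_times p q (M : nat) : set R :=
  [set tau | exists L g, L <= M%:R /\ excursion p q tau L g].

Definition joined p q := exists M, infinite_set (exit_times p q M).

(** One fixed excursion from [q] to [q'] is appended to all excursions from [p] to [q]; the exit
    times are unchanged, so they remain infinitely many. *)
Lemma joined_trans p q q' : joined p q -> joined q q' -> joined p q'.
Proof.
move=> [M hM] [M' hM'].
have [tau' [L' [g' [L'M' ex']]]] : exists tau', exit_times q q' M' tau'.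
  by apply: contrapT => hn; apply: hM'; rewrite (_ : exit_times _ _ _ = set0)//;
    apply/seteqP; split=> // t ht; apply: hn; exists t.
exists (M + M')%N => fin; apply: hM; apply: sub_finite_set fin => tau [L [g [LM ex]]].
exists (L + L'), (splice L g g'); split; first by rewrite natrD lerD.
exact: excursion_splice ex'.
Qed.

Lemma uncountable_itv (T : R) : 0 < T -> ~ countable `]0, T].
Proof.
move=> T0 /countable_lebesgue_measure0.
rewrite lebesgue_measure_itv /= lte_fin T0 sube0 => -[] T1.
by rewrite T1 ltxx in T0.
Qed.

(* Uncountably many exit times but countably many bounds on the duration. *)
Lemma joined_of_excursions (V : set plane) p q1 q2 (T : R) : 0 < T ->
  (forall tau, 0 < tau <= T -> exists q L g,
     [/\ q = q1 \/ q = q2, V q & excursion p q tau L g]) ->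
  exists2 q, (q = q1 \/ q = q2) /\ V q & joined p q.
Proof.
move=> T0 h; apply: contrapT => hn.
have fin q M : (q = q1 \/ q = q2) -> V q -> finite_set (exit_times p q M).
  by move=> hq Vq; apply: contrapT => nf; apply: hn; exists q => //; exists M.
apply: (uncountable_itv T0).
pose A M := [set tau | V q1 /\ exit_times p q1 M tau] `|`
            [set tau | V q2 /\ exit_times p q2 M tau].
apply: (@sub_countable _ _ _ (\bigcup_(M in [set: nat]) A M)); last first.
  apply: bigcup_countable => // M _; apply: finite_set_countable.
  have F q : (q = q1 \/ q = q2) -> finite_set [set tau | V q /\ exit_times p q M tau].
    move=> hq; have [Vq|nVq] := pselect (V q).
      by apply: sub_finite_set (fin _ M hq Vq) => t [].
    by rewrite (_ : [set _ | _] = set0)//; apply/seteqP; split=> // t [].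
  by rewrite finite_setU; split; apply: F; [left|right].
apply: subset_card_le => tau; rewrite /= in_itv /= => /h[q [L [g [hq Vq ex]]]].
have [_ _ _ _ _] := ex; have tauL : 0 < L by case: ex; lra.
exists (Num.Def.archi_bound L) => //.
have ext : exit_times p q (Num.Def.archi_bound L) tau.
  by exists L, g; split=> //; apply/ltW/archi_boundP/ltW.
by case: hq ext Vq => -> ? ?; [left|right].
Qed.

Section Arc.
Context (r_gt0 : (0 < r)%N) (J : set plane).

Lemma excursion_of_slide p (T : R) (c' : R -> plane) tau q m e L g :
  J `<=` sigma_e Z -> c' 0 = p -> follows Z FlowS `[0, T] c' ->
  (forall t, 0 <= t <= T -> J (c' t)) -> 0 < tau <= T ->
  0 < e -> 0 < L -> chain Z e g 0 L -> g 0 = c' tau -> g L = q ->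
  (exists2 d : R, 0 < d & forall t, 0 < t < d -> flow_region Z m (g t)) ->
  excursion p q tau (tau + L) (splice tau c' g).
Proof.
move=> Je c0 hc Jc tauT e0 L0 ch g0 gL [d d0 hd]; split.
- by lra.
- exists (Num.min tau e); first by rewrite lt_min e0; lra.
  apply: chain_splice => //; first by lra.
  apply: chain1; last by lra.
  apply: local_piece_slide; first by lra.
    by move=> t ?; apply/Je/Jc; lra.
  by apply: follows_sub hc => t /=; rewrite !in_itv /=; lra.
- split; first by rewrite /splice (_ : 0 <= tau)//; lra.
  by rewrite /splice leNgt (_ : tau < tau + L) /=; [rewrite addrC addKr|lra].
- move=> t ht; rewrite /splice (_ : t <= tau); last by lra.
  have [[_ ->]] // : sigma_e Z (c' t) by apply/Je/Jc; lra.
- exists d => // t ht; rewrite /splice leNgt (_ : tau < t) /=; last by lra.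
  have : flow_region Z m (g (t - tau)) by apply: hd; lra.
  by case: m {hd} => //= -[_]; [move=> /gt_eqF ->|move=> /lt_eqF ->].
Qed.

(** Pigeonhole on three successive endpoints [g L], [q], [q']: two consecutive equal ones give a
    loop at once; otherwise [q' = g L] and the two links compose. *)
Lemma exists_joined_loop m (c : R -> plane) (K : set plane) :
  {within `[0, 1], continuous c} -> {in `[0, 1] &, injective c} ->
  J = c @` [set` `[0, 1]] -> J `<=` sigma_e Z ->
  (forall p, J p -> escapes_and_returns Z J (sigma_e Z `&` K) (flow_region Z m) p) ->
  exists2 p, J p & joined p p.
Proof.
move=> cc ci Jc Je ret.
have c01 : J (c 0) /\ J (c 1).
  by split; apply: (arc_mem Jc); rewrite ?lexx ?ler01.
have ret' p Jp := return_to_endpoint r_gt0 cc ci Jc Je Jp (ret p Jp).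
(* [slides_inside] is carried to the new endpoint, so that the step can be repeated from it. *)
have step p : slides_inside Z J p -> exists2 q, (q = c 0 \/ q = c 1) /\
    slides_inside Z J q & joined p q.
  move=> [T T0 [c' [c0 hc J']]].
  apply: (joined_of_excursions (T := T)) => // tau tauT.
  have [|e [L [g [[e0 L0 ch g0 dg] [endp sl]]]]] := ret' (c' tau); first by apply: J'; lra.
  exists (g L), (tau + L), (splice tau c' g); split=> //.
  exact: (excursion_of_slide Je c0 hc J' tauT e0 L0 ch g0 (erefl _) dg).
(* A first return supplies an endpoint from which one can slide inside J; nothing of this kind is
   known for [c 0] itself. *)
have [_ [L [g [_ [endp sl]]]]] := ret' _ c01.1.
have [q [eq sq] jq] := step _ sl; have [q' [eq' sq'] jq'] := step _ sq.
have Jend (x : plane) : x = c 0 \/ x = c 1 -> J x by case=> ->; case: c01.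
have [E|n1] := eqVneq (g L) q; first by exists q; [exact: Jend|rewrite -{1}E].
have [E|n2] := eqVneq q' q; first by exists q; [exact: Jend|rewrite -{2}E].
have E : q' = g L.
  move: n1 n2; case: endp => ->; case: eq => ->; case: eq' => -> //;
  by rewrite ?eqxx.
by exists (g L); [exact: Jend|apply: joined_trans jq _; rewrite -E].
Qed.

End Arc.
End Excursions.

(** * Global trajectories coded by words *)

Section GlobalTrajectories.
Context {R : realType} {r : nat} (Z : nsvf (R := R) r).
Local Notation plane := (R * R)%type.
Local Notation f := (sw Z).
Implicit Types (p q : plane) (g : R -> plane) (a b e s t x y L : R).

Lemma global_trajectory_chain g x : global_trajectory Z g ->
  exists e a b, [/\ 0 < e, chain Z e g a b & a < x < b].
Proof.
move=> [t [ct /cvgryPge tp /cvgrNyPle tm]].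
have [N _ hN] := tp (x + 1); have [N' _ hN'] := tm (x - 1).
have h1 := hN _ (leqnn N); have h2 := hN' _ (leqnn N'); rewrite /= in h1 h2.
have [//|e e0 c] := concatenation_chain (i := - N'%:Z) (n := (N' + N)%N) ct.
exists e, (t (- N'%:Z)), (t N%:Z); split=> //; last by lra.
by rewrite (_ : N%:Z = - N'%:Z + (N' + N)%N%:Z)//; lia.
Qed.

Lemma global_trajectory_continuous g : global_trajectory Z g -> continuous g.
Proof.
move=> gg x; have [e [a [b [e0 c axb]]]] := global_trajectory_chain x gg.
apply/continuous_dist => d d0.
have [|d1 d10 h1] := chain_right_cts (t := x) e0 c _ d0; first by lra.
have [|d2 d20 h2] := chain_left_cts (t := x) e0 c _ d0; first by lra.
exists (Num.min d1 d2); first by rewrite lt_min d10.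
move=> y; rewrite lt_min !ltr_norml => /andP[y1 y2].
by have [xy|yx] := leP x y; [apply: h1; lra|apply: h2; lra].
Qed.

(** A trajectory defined for all times is maximal, so invariance of [K] applies to it. *)
Lemma global_trajectory_invariant K g s : invariant Z K ->
  global_trajectory Z g -> K (g s) -> forall t, K (g t).
Proof.
move=> Kinv [t [ct /cvgryPge tp /cvgrNyPle tm]] Ks x.
apply: (Kinv setT g) => //; last by exists s.
split=> [|D' g' _ TD _]; last by apply/seteqP; split.
exists setT, t; split=> //; apply/seteqP; split=> // y _.
have [N _ hN] := tp y; have [N' _ hN'] := tm y.
have h1 := hN _ (leqnn N); have h2 := hN' _ (leqnn N'); rewrite /= in h1 h2.
(* Discrete intermediate value argument: the pieces cover the line because the breakpoints tend to
   both infinities. *)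
have cover n i : t i <= y <= t (i + n%:Z) -> exists j, t j <= y <= t (j + 1).
  elim: n => [|n IH].
    rewrite addr0 => ?; exists i; have [ti _] := ct i I; lra.
  have [le_y|y_lt] := leP y (t (i + n%:Z)); first by move=> ?; apply: IH; lra.
  move=> ?; exists (i + n%:Z); rewrite (_ : i + n%:Z + 1 = i + n.+1%:Z); last by lia.
  by lra.
have [|j hj] := cover (N' + N)%N (- N'%:Z).
  by rewrite (_ : - N'%:Z + (N' + N)%N%:Z = N%:Z); [lra|lia].
by exists j => //=; rewrite in_itv.
Qed.

(** An infinite run of pieces is encoded by a set of breakpoints closed under passing to a next one;
    a sequence is chosen only in [global_of_forward_backward]. *)
Definition forward e g s := exists2 B : set R, B s & forall x, B x ->
  exists y, [/\ B y, x + e <= y & local_piece Z g x y].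

Definition backward e g s := exists2 B : set R, B s & forall y, B y ->
  exists x, [/\ B x, x + e <= y & local_piece Z g x y].

Lemma global_of_forward_backward e g s : 0 < e ->
  forward e g s -> backward e g s -> global_trajectory Z g.
Proof.
move=> e0 [B Bs hB] [B' B's hB'].
have nxt x : exists y, B x -> [/\ B y, x + e <= y & local_piece Z g x y].
  by have [/hB[y]|nB] := pselect (B x); [exists y|exists 0].
have prv y : exists x, B' y -> [/\ B' x, x + e <= y & local_piece Z g x y].
  by have [/hB'[y']|nB] := pselect (B' y); [exists y'|exists 0].
have [F hF] := choice nxt; have [G hG] := choice prv.
have BF n : B (iter n F s) by elim: n => //= n /hF[].
have BG n : B' (iter n G s) by elim: n => //= n /hG[].
have geF n : s + n%:R * e <= iter n F s.
  elim: n => [|n IH] /=; first by rewrite mul0r addr0.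
  by have [_ + _] := hF _ (BF n); rewrite -natr1 mulrDl; lra.
have leG n : iter n G s <= s - n%:R * e.
  elim: n => [|n IH] /=; first by rewrite mul0r subr0.
  by have [_ + _] := hG _ (BG n); rewrite -natr1 mulrDl; lra.
(* [Negz n] is [- (n + 1)], hence the successor; the last branch is never reached. *)
pose t i := if i is Posz n then iter n F s else if i is Negz n then iter n.+1 G s else 0.
have tN n : t (- n%:Z) = iter n G s by case: n => [|n] //=; rewrite -NegzE.
have bd (A : R) : exists N, forall n, (N <= n)%N -> A <= n%:R * e.
  exists (Num.Def.archi_bound (`|A| / e)) => n Nn.
  rewrite -ler_pdivrMr//; apply: le_trans (_ : `|A| / e <= _).
    by rewrite ler_pM2r ?invr_gt0// ler_norm.
  apply/ltW/(lt_le_trans (archi_boundP _)); last by rewrite ler_nat.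
  by rewrite divr_ge0// ltW.
exists t; split.
- move=> [n|n] _.
    have [_ h1 h2] := hF _ (BF n); rewrite (_ : Posz n + 1 = n.+1); last by lia.
    by split=> //=; lra.
  have [_ h1 h2] := hG _ (BG n); rewrite (_ : Negz n + 1 = - n%:Z); last by lia.
  by rewrite tN; split=> //=; move: h1; rewrite /=; lra.
- apply/cvgryPge => A; have [N hN] := bd (A - s); exists N => // n /= Nn.
  by have := hN _ Nn; have := geF n; lra.
- apply/cvgrNyPle => A; have [N hN] := bd (s - A); exists N => // n /= Nn.
  by rewrite tN; have := hN _ Nn; have := leG n; lra.
Qed.

Lemma chain_forward e g a b : chain Z e g a b -> forward e g b -> forward e g a.
Proof.
elim=> // {}a a' {}b h1 h2 _ IH /IH[B Ba' hB].
exists (B `|` [set a]); first by right.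
move=> x [/hB[y [By xy hy]]|->]; first by exists y; split=> //; left.
by exists a'; split=> //; left.
Qed.

Lemma chain_first e g a b : chain Z e g a b ->
  a = b \/ exists a', [/\ local_piece Z g a a', a + e <= a' & chain Z e g a' b].
Proof. by case=> [x|x a' y h1 h2 c]; [left|right; exists a']. Qed.

Lemma chain_last e g a b : chain Z e g a b ->
  a = b \/ exists b', [/\ local_piece Z g b' b, b' + e <= b & chain Z e g a b'].
Proof.
elim=> [x|x a' y h1 h2 c [E|[b' [h3 h4 c']]]]; [by left| |].
  by right; exists x; rewrite -E; split=> //; exact: ChainNil.
by right; exists b'; split=> //; exact: ChainCons c'.
Qed.

(** The breakpoints are all times from which a chain leads to [C]. When that chain is empty, the
    next one is not, because [x < y]. *)
Lemma forward_of_chains e g (C : set R) :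
  (forall x, C x -> exists y, [/\ C y, x < y & chain Z e g x y]) ->
  forall x, C x -> forward e g x.
Proof.
move=> h x Cx; exists [set a | exists2 b, C b & chain Z e g a b].
  by exists x => //; exact: ChainNil.
have step a b : chain Z e g a b -> a < b -> C b ->
    exists y, [/\ exists2 b, C b & chain Z e g y b, a + e <= y & local_piece Z g a y].
  move=> /chain_first[->|[a' [h1 h2 c]]]; rewrite ?ltxx// => _ Cb.
  by exists a'; split=> //; exists b.
move=> a [b Cb c]; have [E|[a' [h1 h2 c']]] := chain_first c.
  by have [y [Cy ay cy]] := h _ Cb; rewrite E; exact: step cy ay Cy.
by exists a'; split=> //; exists b.
Qed.

Lemma backward_of_chains e g (C : set R) :
  (forall y, C y -> exists x, [/\ C x, x < y & chain Z e g x y]) ->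
  forall y, C y -> backward e g y.
Proof.
move=> h x Cx; exists [set b | exists2 a, C a & chain Z e g a b].
  by exists x => //; exact: ChainNil.
have step a b : chain Z e g a b -> a < b -> C a ->
    exists y, [/\ exists2 a, C a & chain Z e g a y, y + e <= b & local_piece Z g y b].
  move=> /chain_last[->|[b' [h1 h2 c]]]; rewrite ?ltxx// => _ Ca.
  by exists b'; split=> //; exists a.
move=> b [a Ca c]; have [E|[b' [h1 h2 c']]] := chain_last c.
  by have [y [Cy ya cy]] := h _ Ca; rewrite -E; exact: step cy ya Cy.
by exists b'; split=> //; exists a.
Qed.

Lemma eq_forward e g g' s : 0 < e -> (forall t, s <= t -> g t = g' t) ->
  forward e g s -> forward e g' s.
Proof.
move=> e0 E [B Bs hB]; exists (B `&` [set t | s <= t]); first by split=> /=.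
move=> x [/hB[y [By xy h]] /= sx]; exists y; split=> //.
  by split=> //=; lra.
by apply: eq_local_piece h => t ?; apply: E; lra.
Qed.

Lemma eq_backward e g g' s : 0 < e -> (forall t, t <= s -> g t = g' t) ->
  backward e g s -> backward e g' s.
Proof.
move=> e0 E [B Bs hB]; exists (B `&` [set t | t <= s]); first by split=> /=.
move=> y [/hB[x [Bx xy h]] /= ys]; exists x; split=> //.
  by split=> //=; lra.
by apply: eq_local_piece h => t ?; apply: E; lra.
Qed.

Lemma forward_shift e g k s : forward e g (k + s) -> forward e (fun t => g (k + t)) s.
Proof.
move=> [B Bs hB]; exists [set t | B (k + t)] => // x /hB[y [By xy h]].
exists (y - k); rewrite /= (_ : k + (y - k) = y); last by ring.
split=> //; first by lra.
by apply: local_piece_shift; rewrite (_ : k + (y - k) = y)//; ring.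
Qed.

Section Periodic.
Context (e L : R) (l : R -> plane).
Context (e0 : 0 < e) (L0 : 0 < L) (ch : chain Z e l 0 L) (ends : l 0 = l L).

Definition periodic t : plane := l (t - L * (Num.floor (t / L))%:~R).

(** The right end, where the floor jumps, is included because the loop closes up ([ends]); pieces
    live on closed intervals. *)
Lemma periodicE (n : int) t : n%:~R * L <= t <= (n + 1)%:~R * L ->
  periodic t = l (t - n%:~R * L).
Proof.
move=> /andP[nt]; rewrite le_eqVlt => /predU1P[->|tn].
  rewrite /periodic mulfK ?gt_eqF// intrKfloor mulrC subrr ends; congr l.
  by rewrite intrD; ring.
rewrite /periodic (_ : Num.floor (t / L) = n); first by rewrite mulrC.
by apply: floor_def; rewrite ler_pdivlMr// ltr_pdivrMr// nt.
Qed.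

Lemma periodic_chain (n : int) : chain Z e periodic (n%:~R * L) ((n + 1)%:~R * L).
Proof.
apply: (eq_chain (g := fun t => l (- (n%:~R * L) + t)) e0).
  by move=> t /periodicE ->; rewrite addrC.
apply: chain_shift; rewrite addNr (_ : - _ + _ = L)//.
by rewrite intrD; ring.
Qed.

Lemma periodic0 : periodic 0 = l 0.
Proof. by rewrite /periodic mul0r floor0 mulr0 subr0. Qed.

Lemma periodic_forward : forward e periodic 0.
Proof.
apply: (@forward_of_chains _ _ [set x | exists n : int, x = n%:~R * L]); last first.
  by exists 0; rewrite mul0r.
move=> x [n ->]; exists ((n + 1)%:~R * L); split; first by exists (n + 1).
  by rewrite ltr_pM2r// ltr_int; lia.
exact: periodic_chain.
Qed.

Lemma periodic_backward : backward e periodic 0.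
Proof.
apply: (@backward_of_chains _ _ [set x | exists n : int, x = n%:~R * L]); last first.
  by exists 0; rewrite mul0r.
move=> x [n ->]; exists ((n - 1)%:~R * L); split; first by exists (n - 1).
  by rewrite ltr_pM2r// ltr_int; lia.
by have := periodic_chain (n - 1); rewrite subrK.
Qed.

End Periodic.

Section Words.
Context (k : nat) (i0 : 'I_k) (p : plane) (e : R) (L : 'I_k -> R) (l : 'I_k -> R -> plane).
Context (e0 : 0 < e) (L0 : forall i, 0 < L i) (ch : forall i, chain Z e (l i) 0 (L i)).
Context (l0 : forall i, l i 0 = p) (lL : forall i, l i (L i) = p).

(** Loop [i0] is repeated before time 0 and after the last letter, so that a finite word gives a
    curve defined for all times. *)
Fixpoint word_curve (w : seq 'I_k) (t : R) : plane :=
  if w is i :: w' then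
    if t < 0 then periodic (L i0) (l i0) t
    else if t < L i then l i t else word_curve w' (t - L i)
  else periodic (L i0) (l i0) t.

Lemma word_curve0 w : word_curve w 0 = p.
Proof.
case: w => [|i w] /=; first by rewrite periodic0 l0.
by rewrite ltxx L0 l0.
Qed.

Lemma word_curve_cons i w t : 0 <= t ->
  word_curve (i :: w) t = if t < L i then l i t else word_curve w (t - L i).
Proof. by move=> t0; rewrite /= ltNge t0. Qed.

Lemma word_curve_global w : global_trajectory Z (word_curve w).
Proof.
have ends i : l i 0 = l i (L i) by rewrite l0 lL.
apply: (@global_of_forward_backward e _ 0) => //; last first.
  apply: eq_backward e0 _ (periodic_backward e0 (L0 i0) (ch i0) (ends i0)).
  move=> t; rewrite le_eqVlt => /predU1P[->|t0]; first by rewrite word_curve0 periodic0 l0.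
  by case: w => //= i w; rewrite t0.
elim: w => [|i w IH]; first exact: periodic_forward e0 (L0 i0) (ch i0) (ends i0).
apply: (@chain_forward _ _ _ (L i)).
  apply: eq_chain e0 _ (ch i) => t /andP[t0]; rewrite word_curve_cons//.
  rewrite le_eqVlt => /predU1P[->|->//].
  by rewrite ltxx subrr word_curve0 lL.
apply: (eq_forward (g := fun t => word_curve w (- L i + t)) e0).
  move=> t tL; rewrite word_curve_cons; last by apply: le_trans tL; exact/ltW.
  by rewrite ltNge tL addrC.
by apply: forward_shift; rewrite addNr.
Qed.

(** Both curves run a common prefix during the same time, so the first differing letters start at a
    common time [t]; each letter up to these costs at most [M]. *)
Lemma word_curve_split (M : R) (w w' : seq 'I_k) : (forall i, L i <= M) ->
  size w = size w' -> w != w' -> exists t i j,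
  [/\ 0 <= t, t + M <= (size w)%:R * M, i != j,
    forall s, 0 <= s < L i -> word_curve w (t + s) = l i s &
    forall s, 0 <= s < L j -> word_curve w' (t + s) = l j s].
Proof.
move=> LM; elim: w w' => [|i w IH] [|j w'] //= [sz] ne.
have M0 : 0 <= M by apply: le_trans (LM i0); exact/ltW.
have szM : (size w).+1%:R * M = M + (size w)%:R * M by rewrite -natr1; ring.
have [ij|nij] := eqVneq i j; last first.
  exists 0, i, j; split=> // [|s /andP[s0 s1]|s /andP[s0 s1]].
  - by rewrite szM add0r lerDl mulr_ge0.
  - by rewrite add0r ltNge s0 /= s1.
  - by rewrite add0r ltNge s0 /= s1.
rewrite -{j}ij in ne *.
have [|t [i' [j' [t0 tM nij' h h']]]] := IH w' sz.
  by apply: contraNneq ne => ->.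
have Li := L0 i; exists (L i + t), i', j'; split=> // [||s sL|s sL].
- by lra.
- by have := LM i; lra.
- rewrite ltNge (_ : 0 <= L i + t + s) /=; last by lra.
  rewrite ltNge (_ : L i <= L i + t + s) /=; last by lra.
  by rewrite (_ : L i + t + s - L i = t + s) ?h//; ring.
- rewrite ltNge (_ : 0 <= L i + t + s) /=; last by lra.
  rewrite ltNge (_ : L i <= L i + t + s) /=; last by lra.
  by rewrite (_ : L i + t + s - L i = t + s) ?h'//; ring.
Qed.

End Words.

End GlobalTrajectories.

(** * Distances and entropy *)

Section Distances.
Context {R : realType}.
Local Notation plane := (R * R)%type.
Local Notation mu := (@lebesgue_measure R).
Implicit Types (g : R -> plane) (u v : plane).

Lemma norm_le_enorm u : `|u| <= enorm u.
Proof.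
rewrite /enorm /dot; apply: normr_pair_le; rewrite -sqrtr_sqr ler_sqrt ?expr2.
- by rewrite lerDl -expr2 sqr_ge0.
- by rewrite addr_ge0// -expr2 sqr_ge0.
- by rewrite lerDr -expr2 sqr_ge0.
- by rewrite addr_ge0// -expr2 sqr_ge0.
Qed.

Lemma continuous_translate g (s : R) : continuous g -> continuous (fun t => g (t + s)).
Proof.
move=> cg t; apply: (@continuous_comp _ _ _ (fun t => t + s) g); last exact: cg.
by apply: cvgD; [exact: cvg_id|exact: cvg_cst].
Qed.

Lemma continuous_dist_shift g g' (s : R) : continuous g -> continuous g' ->
  continuous (fun t => `|g (t + s) - g' (t + s)|).
Proof.
by move=> cg cg' t; apply: cvg_norm; apply: cvgB; exact: continuous_translate.
Qed.

Lemma continuous_enorm_shift g g' (s : R) : continuous g -> continuous g' ->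
  continuous (fun t => enorm (g (t + s) - g' (t + s))).
Proof.
move=> cg cg'.
have cB : continuous (fun t => g (t + s) - g' (t + s)).
  by move=> t; apply: cvgB; exact: continuous_translate.
move=> t; apply: (@continuous_comp _ _ _
  (fun t => dot (g (t + s) - g' (t + s)) (g (t + s) - g' (t + s))) Num.sqrt);
  last exact: sqrt_continuous.
have c1 := cvg_comp _ _ (cB t) (@cvg_fst _ _ _ _ _).
have c2 := cvg_comp _ _ (cB t) (@cvg_snd _ _ _ _ _).
by apply: cvgD; apply: cvgM; [exact: c1|exact: c1|exact: c2|exact: c2].
Qed.

Lemma measurable_EFin_continuous (F : R -> R) (D : set R) :
  continuous F -> measurable_fun D (EFin \o F).
Proof.
by move=> cF; apply/measurable_EFinP/measurable_funTS; exact: continuous_measurable_fun.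
Qed.

Lemma integral_ge_on_segment (F : R -> R) (a b k : R) : continuous F ->
  (forall t, 0 <= F t) -> 0 <= a <= b -> b <= 1 -> 0 <= k ->
  (forall t, a <= t <= b -> k <= F t) ->
  ((k * (b - a))%:E <= \int[mu]_(t in `[0%R, 1%R]) (F t)%:E)%E.
Proof.
move=> cF F0 /andP[a0 ab] b1 k0 hk.
have <- : (\int[mu]_(t in `[a, b]) (cst k%:E) t = (k * (b - a))%:E)%E.
  rewrite integral_cst//= lebesgue_measure_itv /= lte_fin.
  move: ab; rewrite le_eqVlt => /predU1P[->|->]; last by rewrite -EFinB EFinM.
  by rewrite ltxx subrr mulr0 mule0.
have sub : `[a, b] `<=` `[0, 1] by move=> t; rewrite /= !in_itv /=; lra.
have h1 : (\int[mu]_(t in `[a, b]) (EFin \o F) t <= \int[mu]_(t in `[0%R, 1%R]) (EFin \o F) t)%E.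
  apply: ge0_subset_integral => //; first exact: measurable_EFin_continuous.
  by move=> t _; rewrite lee_fin.
apply: le_trans h1; apply: ge0_le_integral => //.
  exact: measurable_EFin_continuous.
Qed.

Lemma integral_dist_triangle g g1 g2 (s : R) :
  continuous g -> continuous g1 -> continuous g2 ->
  (\int[mu]_(t in `[0%R, 1%R]) `|g1 (t + s) - g2 (t + s)|%:E <=
   \int[mu]_(t in `[0%R, 1%R]) (enorm (g (t + s) - g1 (t + s)))%:E +
   \int[mu]_(t in `[0%R, 1%R]) (enorm (g (t + s) - g2 (t + s)))%:E)%E.
Proof.
move=> cg c1 c2.
have m1 := @measurable_EFin_continuous _ `[0, 1] (@continuous_enorm_shift _ _ s cg c1).
have m2 := @measurable_EFin_continuous _ `[0, 1] (@continuous_enorm_shift _ _ s cg c2).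
rewrite -ge0_integralD//; try by move=> t _; rewrite lee_fin sqrtr_ge0.
apply: ge0_le_integral => //.
- exact: (measurable_EFin_continuous (@continuous_dist_shift _ _ s c1 c2)).
- exact: emeasurable_funD.
move=> t _; rewrite -EFinD lee_fin.
apply: le_trans (lerD (norm_le_enorm _) (norm_le_enorm _)).
rewrite [X in _ <= X + _]distrC; exact: ler_distD.
Qed.

Lemma iter_time_one n g : iter n time_one g = fun t => g (t + n%:R).
Proof.
elim: n g => [|n IH] g; first by apply/funext => t; rewrite addr0.
by rewrite iterSr IH; apply/funext => t; rewrite /time_one -addrA -natr1.
Qed.

(** After [i] iterates of [time_one], only the term of index 0 of [rho], of weight 1, is kept. *)
Lemma dist_n_ge n g1 g2 i : (i < n)%N ->
  (\int[mu]_(t in `[0%R, 1%R]) (enorm (g1 (t + i%:R) - g2 (t + i%:R)))%:E <=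
   dist_n rho time_one n g1 g2)%E.
Proof.
move=> ltin; apply: le_trans (le_bigmax _ _ (Ordinal ltin)).
rewrite /= !iter_time_one /rho; apply: esum_ge; exists [set 0] => //.
by rewrite fsbig_set1 add0r expr0 mul1e.
Qed.

Lemma spanned_dist (e d : R) n g g1 g2 i : (i < n)%N ->
  continuous g -> continuous g1 -> continuous g2 ->
  (dist_n rho time_one n g g1 < e%:E)%E -> (dist_n rho time_one n g g2 < e%:E)%E ->
  (d%:E <= \int[mu]_(t in `[0%R, 1%R]) `|g1 (t + i%:R) - g2 (t + i%:R)|%:E)%E ->
  d < e + e.
Proof.
move=> ltin cg c1 c2 h1 h2 hd; rewrite -lte_fin EFinD.
apply: le_lt_trans hd _; apply: le_lt_trans (integral_dist_triangle _ cg c1 c2) _.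
by apply: lteD;
  [exact: le_lt_trans (dist_n_ge _ _ ltin) h1|exact: le_lt_trans (dist_n_ge _ _ ltin) h2].
Qed.

End Distances.

(** * Separation of coded trajectories and the lower bound for the entropy *)

Section Entropy.
Context {R : realType} {r : nat} (Z : nsvf (R := R) r).
Local Notation plane := (R * R)%type.
Local Notation f := (sw Z).
Local Notation mu := (@lebesgue_measure R).
Implicit Types (g : R -> plane).

(** Shortly after [tau] the first curve has left Sigma and the second has not. The window of this
    disagreement moves with [t] and may straddle an integer, while [rho] integrates over unit
    intervals; [d] is therefore computed from half a window, and does not depend on [t]. *)
Lemma separated_excursions (p q p' q' : plane) (tau tau' L L' M : R) (l l' : R -> plane) :
  excursion Z p q tau L l -> excursion Z p' q' tau' L' l' -> tau < tau' ->
  L <= M -> L' <= M -> exists2 d : R, 0 < d & forall g1 g2 (t : R) (n : nat),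
    continuous g1 -> continuous g2 -> 0 <= t -> t + M <= n%:R ->
    (forall s, 0 <= s < L -> g1 (t + s) = l s) ->
    (forall s, 0 <= s < L' -> g2 (t + s) = l' s) ->
    exists2 m, (m < n)%N &
      (d%:E <= \int[mu]_(t in `[0%R, 1%R]) `|g1 (t + m%:R) - g2 (t + m%:R)|%:E)%E.
Proof.
move=> [tL [e e0 c] _ _ [d d0 lf]] [tL' [e' e'0 c'] _ l'f _] tt' LM LM'.
have [x0 [x1 x2 x3 x4]] : exists x0, [/\ tau < x0, x0 < tau + d, x0 < tau' & x0 < L].
  pose m := Num.min d (Num.min (tau' - tau) (L - tau)).
  have m0 : 0 < m by rewrite !lt_min; lra.
  have m1 : m <= d by rewrite ge_min lexx.
  have m2 : m <= tau' - tau by rewrite !ge_min lexx !orbT.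
  have m3 : m <= L - tau by rewrite !ge_min lexx !orbT.
  by exists (tau + m / 2); split; lra.
have ne : l x0 != l' x0.
  by apply: contraTneq (lf x0 _) => [->|]; [rewrite l'f ?eqxx//; lra|rewrite x1].
(* Each curve drifts by less than [k] on the window chosen below, so at least half of the initial
   distance [4 * k] remains. *)
pose k := `|l x0 - l' x0| / 4.
have k0 : 0 < k by rewrite divr_gt0// normr_gt0 subr_eq0.
have [|h1 h10 H1] := chain_right_cts (t := x0) e0 c _ k0; first by lra.
have [|h2 h20 H2] := chain_right_cts (t := x0) e'0 c' _ k0; first by lra.
have [h [h0 hh1 hh2 [hL hL' h11]]] : exists h, [/\ 0 < h, 2 * h < h1, 2 * h < h2 &
    [/\ x0 + 2 * h < L, x0 + 2 * h < L' & 2 * h < 1]].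
  pose m := Num.min (Num.min h1 h2) (Num.min (L - x0) (Num.min (L' - x0) 1)).
  have m0 : 0 < m by rewrite !lt_min; lra.
  have m1 : m <= h1 by rewrite !ge_min lexx.
  have m2 : m <= h2 by rewrite !ge_min lexx !orbT.
  have m3 : m <= L - x0 by rewrite !ge_min lexx !orbT.
  have m4 : m <= L' - x0 by rewrite !ge_min lexx !orbT.
  have m5 : m <= 1 by rewrite !ge_min lexx !orbT.
  by exists (m / 3); split; [|lra|lra|split]; lra.
have sep s : x0 <= s <= x0 + 2 * h -> k <= `|l s - l' s|.
  move=> hs; have a1 : `|l s - l x0| < k by apply: H1; lra.
  have a2 : `|l' s - l' x0| < k by apply: H2; lra.
  have : `|l x0 - l' x0| <= `|l x0 - l s| + `|l s - l' s| + `|l' s - l' x0|.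
    by apply: le_trans (ler_distD (l' s) _ _) _; rewrite lerD2r ler_distD.
  by rewrite [`|l x0 - l s|]distrC {1}(_ : `|l x0 - l' x0| = 4 * k); [lra|rewrite /k; field].
exists (k * h); first by rewrite mulr_gt0.
move=> g1 g2 t n c1 c2 t0 tn E1 E2; set X := t + x0.
have X0 : 0 <= X by rewrite /X; lra.
(* The window [[X, X + 2 * h]] is shorter than 1, so one of its halves [[y, y + h]] lies between
   consecutive integers. *)
have [m [y [Xy yX my ym]]] : exists m : nat, exists y, [/\ X <= y, y + h <= X + 2 * h,
    m%:R <= y & y + h <= m%:R + 1].
  have := truncn_itv X0; set m := Num.trunc X; rewrite -natr1 => /andP[m1 m2].
  have [a|a] := leP (X + h) (m%:R + 1); first by exists m, X; split; lra.
  by exists m.+1, (X + h); rewrite -natr1; split; lra.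
exists m.
  rewrite -(ltr_nat R); apply: le_lt_trans my _; apply: lt_le_trans tn.
  by move: yX; rewrite /X; lra.
rewrite (_ : k * h = k * (y - m%:R + h - (y - m%:R))); last by ring.
apply: (@integral_ge_on_segment _ (fun s => `|g1 (s + m%:R) - g2 (s + m%:R)|)) => //.
- exact: continuous_dist_shift.
- by lra.
- by lra.
- exact: ltW.
move=> s hs; rewrite (_ : s + m%:R = t + (s + m%:R - t)); last by ring.
by rewrite E1 ?E2; [apply: sep| |]; move: Xy yX; rewrite /X; lra.
Qed.

Lemma finite_lower_bound (I : finType) (d : I -> R) : (forall i, 0 < d i) ->
  exists2 e, 0 < e & forall i, e <= d i.
Proof.
move=> d0; exists (\big[Num.min/1]_i d i); first exact: lt_bigmin.
by move=> i; exact: bigmin_le.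
Qed.

Lemma finType_card_le (T : finType) U (E : set U) N (y : T -> U) :
  (forall w, E (y w)) -> injective y -> (E #= `I_N)%card -> (#|T| <= N)%N.
Proof.
move=> Ey yi; rewrite card_eq_le => /andP[/pcard_leP[h] _].
have hN w : (h (y w) < N)%N by have := @funS _ _ _ _ h _ (Ey w).
suff: injective (fun w => Ordinal (hN w)) by move=> /leq_card; rewrite card_ord.
move=> w w' [/(@inj _ _ _ h)]; rewrite !inE => /(_ (Ey w) (Ey w')).
exact: yi.
Qed.

(** Sending a word to a centre whose ball contains its curve is injective: two curves with a common
    centre differ by less than [e + e] on each unit interval up to time [m * M], whereas the first
    differing letters separate them by [d]. *)
Lemma span_card_ge K p k M (tau L : 'I_k.+1 -> R) (l : 'I_k.+1 -> R -> plane) :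
  invariant Z K -> K p -> injective tau ->
  (forall i, L i <= M%:R /\ excursion Z p p (tau i) (L i) (l i)) ->
  exists2 d : R, 0 < d & forall (e : R) m, e + e <= d ->
    ((k.+1 ^ m)%:R%:E <= span_card rho (Omega Z K) time_one e (m * M))%E.
Proof.
move=> Kinv Kp tau_inj ex.
have LM i : L i <= M%:R by have [] := ex i.
have L0 i : 0 < L i by have [_ [+ _ _ _ _]] := ex i; lra.
have l0 i : l i 0 = p by have [_ [_ _ [] ]] := ex i.
have lL i : l i (L i) = p by have [_ [_ _ [] ]] := ex i.
have ex_step i : exists e : R, 0 < e /\ chain Z e (l i) 0 (L i).
  by have [_ [_ [e e0 c] _ _ _]] := ex i; exists e.
have [es hes] := choice ex_step.
(* Finitely many loops share a lower bound on the lengths of their pieces, as [word_curve_global]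
   requires. *)
have [e e0 hel] := finite_lower_bound (fun i => (hes i).1).
have ch i : chain Z e (l i) 0 (L i) by exact: chain_weaken (hel i) (hes i).2.
pose curve := word_curve ord0 L l.
have curve_global w : global_trajectory Z (curve w) by exact: word_curve_global e0 L0 ch l0 lL w.
have curve_Omega w : Omega Z K (curve w).
  split; first exact: curve_global.
  apply: (global_trajectory_invariant (s := 0) Kinv (curve_global w)).
  by rewrite /curve (word_curve0 ord0 L0 l0).
pose far (i j : 'I_k.+1) (d : R) := forall g1 g2 (t : R) (n : nat),
    continuous g1 -> continuous g2 -> 0 <= t -> t + M%:R <= n%:R ->
    (forall s, 0 <= s < L i -> g1 (t + s) = l i s) ->
    (forall s, 0 <= s < L j -> g2 (t + s) = l j s) ->
    exists2 m, (m < n)%N &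
      (d%:E <= \int[mu]_(t in `[0%R, 1%R]) `|g1 (t + m%:R) - g2 (t + m%:R)|%:E)%E.
(* The value 1 on the diagonal is a default. Off the diagonal the curves are swapped if necessary,
   since [separated_excursions] takes ordered exit times. *)
have ex_far ij : exists d : R, 0 < d /\ (ij.1 != ij.2 -> far ij.1 ij.2 d).
  case: ij => i j /=; have [->|nij] := eqVneq i j; first by exists 1.
  have [[Li exi] [Lj exj]] := (ex i, ex j).
  have : tau i != tau j by apply: contra nij => /eqP/tau_inj ->.
  rewrite neq_lt => /orP[ij|ji].
    by have [d d0 hd] := separated_excursions exi exj ij Li Lj; exists d; split.
  have [d d0 hd] := separated_excursions exj exi ji Lj Li; exists d; split=> // _.
  move=> g1 g2 t n c1 c2 t0 tn h1 h2; have [m mn hm] := hd g2 g1 t n c2 c1 t0 tn h2 h1.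
  by exists m => //; under eq_integral do rewrite distrC.
have [ds hds] := choice ex_far.
have [d d0 hd] := finite_lower_bound (fun ij => (hds ij).1).
exists d => // e' m e'd; apply/ereal_infP => _ [N [E [EO spE] EN] <-].
rewrite lee_fin ler_nat (_ : (k.+1 ^ m)%N = #|{: m.-tuple 'I_k.+1}|); last first.
  by rewrite card_tuple card_ord.
have ex_center (w : m.-tuple 'I_k.+1) : exists y, E y /\
    (dist_n rho time_one (m * M) y (curve w) < e'%:E)%E.
  by have [y Ey yw] := spE _ (curve_Omega w); exists y.
have [y hy] := choice ex_center.
apply: (finType_card_le (fun w => (hy w).1) _ EN) => w w' yww'.
apply/eqP; apply: contraT => nww'.
have [t [i [j [t0 tM nij h1 h2]]]] :
    exists t i j, [/\ 0 <= t, t + M%:R <= (size w)%:R * M%:R, i != j,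
    forall s, 0 <= s < L i -> curve w (t + s) = l i s &
    forall s, 0 <= s < L j -> curve w' (t + s) = l j s].
  by apply: word_curve_split => //; rewrite !size_tuple.
have c1 := global_trajectory_continuous (curve_global w).
have c2 := global_trajectory_continuous (curve_global w').
have [|a an ha] := (hds (i, j)).2 nij _ _ t (m * M)%N c1 c2 t0 _ h1 h2.
  by rewrite natrM; rewrite size_tuple in tM.
have cy : continuous (y w) by apply: global_trajectory_continuous; exact: (EO _ (hy w).1).1.
have := spanned_dist an cy c1 c2 (hy w).2 _ ha.
rewrite yww' => /(_ (hy w').2).
by have := hd (i, j); lra.
Qed.

(** At the times [m * M] the growth rate is at least [ln (k ^ m) / (m * M) = ln k / M], and a limit
    superior only needs such a subsequence. *)
Lemma entropy_at_ge (T : Type) (dist : T -> T -> \bar R) (W : set T) (g : T -> T) (e : R) k M :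
  (0 < M)%N -> (0 < k)%N ->
  (forall m, ((k ^ m)%:R%:E <= span_card dist W g e (m * M))%E) ->
  ((ln k%:R / M%:R)%:E <= entropy_at dist W g e)%E.
Proof.
move=> M0 k0 h; rewrite /entropy_at limn_esup_lim.
apply: lime_ge; first exact: is_cvg_esups.
exists 0%N => // n _ /=; set u := (fun n : nat => _).
(* The index [n.+1 * M] lies in the tail starting at [n], and the successor makes it a nonzero
   denominator. *)
apply: (@le_trans _ _ (u (n.+1 * M)%N)); last first.
  by apply: ereal_sup_ubound; exists (n.+1 * M)%N => //=; nia.
have nM0 : (0 : R) < (n.+1 * M)%:R by rewrite ltr0n muln_gt0.
have kn0 : (0 : R) < (k ^ n.+1)%:R by rewrite ltr0n expn_gt0 k0.
rewrite /u (_ : ln k%:R / M%:R = (n.+1 * M)%:R^-1 * ln (k ^ n.+1)%:R); last first.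
  rewrite natrX lnXn ?ltr0n// -mulr_natl natrM.
  by field; rewrite addrC natr1 !pnatr_eq0 -lt0n M0.
rewrite EFinM; apply: lee_wpmul2l; first by rewrite lee_fin invr_ge0 ltW.
rewrite -lne_EFin// lee_lne ?h// in_itv /= ?lee_fin ?leey ?andbT; first exact: ltW.
by apply: le_trans (h n.+1); rewrite lee_fin ltW.
Qed.

Lemma entropy_of_joined K p : invariant Z K -> K p -> joined Z p p ->
  nsvf_entropy Z K = +oo%E.
Proof.
move=> Kinv Kp [M inf]; rewrite /nsvf_entropy /entropy.
apply: cvg_lim => //; apply/cvgeyPge => A.
(* [s] injects the naturals into the exit times; its first [k.+1] values give the alphabet, with [k]
   chosen below so that [ln k.+1 / M] exceeds the target [A]. *)
have /infiniteP/pcard_leP[s] := inf.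
have s_ex i : exit_times Z p p M (s i) by exact: (@funS _ _ _ _ s).
have M0 : (0 < M)%N.
  have [L [l [LM [+ _ _ _ _]]]] := s_ex 0%N; rewrite -(ltr0n R); lra.
have [k Ak] : exists k : nat, A <= ln k.+1%:R / M%:R.
  exists (Num.Def.archi_bound (expR (A * M%:R))); rewrite ler_pdivlMr ?ltr0n//.
  rewrite -[leLHS]expRK ler_ln ?posrE ?expR_gt0 ?ltr0n//.
  apply/ltW/(lt_trans (archi_boundP (expR_ge0 _))); rewrite ltr_nat; exact: ltnSn.
have [L hL] := choice (fun i : 'I_k.+1 => s_ex i).
have [l hl] := choice hL.
have tau_inj : injective (fun i : 'I_k.+1 => s i).
  by move=> i j /(@inj _ _ _ s)/[!inE]/(_ Logic.I Logic.I)/val_inj.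
have [d d0 hd] := span_card_ge Kinv Kp tau_inj hl.
have d2 : 0 < d / 2 by rewrite divr_gt0.
near=> e; apply: (@le_trans _ _ (ln k.+1%:R / M%:R)%:E); first by rewrite lee_fin.
apply: entropy_at_ge => // m; apply: hd.
have : e < d / 2 by near: e; exact: nbhs_right_lt.
by lra.
Unshelve. all: by end_near. Qed.

End Entropy.

Unset Implicit Arguments.

Theorem theorem6p2 (R : realType) (r : nat) (hr : (1 < r)%N)
    (Z : nsvf (R := R) r) (K : set (R * R))
    (K_compact : compact K) (K_dom : K `<=` dom Z) (K_inv : invariant Z K)
    (Se_neq0 : (sigma_e Z `&` K) !=set0)
    (J : set (R * R)) (J_arc : closed_arc J) (J_sub : J `<=` sigma_e Z `&` K)
    (J_ret :
      (forall x, J x ->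
         escapes_and_returns Z J (sigma_e Z `&` K) (sigma_plus Z) x) \/
      (forall x, J x ->
         escapes_and_returns Z J (sigma_e Z `&` K) (sigma_minus Z) x)) :
  nsvf_entropy Z K = +oo%E.
Proof.
have r0 : (0 < r)%N by exact: ltnW.
have [c [cc ci Jc]] := J_arc.
have Je : J `<=` sigma_e Z by move=> x /J_sub[].
have [p Jp pp] : exists2 p, J p & joined Z p p.
  case: J_ret => ret.
    exact: (exists_joined_loop r0 (m := FlowX) cc ci Jc Je ret).
  exact: (exists_joined_loop r0 (m := FlowY) cc ci Jc Je ret).
by apply: entropy_of_joined K_inv _ pp; have [] := J_sub _ Jp.
Qed.
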